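(* Let $p$ be a prime and let $G$ be a group of order $p^3$. Then $$E(G)=\mathsf d(G)+|G|.$$
   Context: Let $G$ be a finite group with identity $1$. A sequence over $G$ is a finite unordered list of elements of $G$ with repetition allowed (a finite multiset, i.e. an element of the free abelian monoid on $G$); its length is the number of terms counted with multiplicity, and a subsequence is a sub-multiset. A nonempty sequence is called product-one if its terms can be ordered so that their product in $G$ (in that order) equals $1$. A sequence is product-one free if it has no nonempty product-one subsequence. The small Davenport constant $\mathsf d(G)$ is the largest integer $\ell$ such that there exists a product-one free sequence over $G$ of length $\ell$ (the empty sequence is product-one free). The Gao constant $E(G)$ is the least integer $\ell$ such that every sequence over $G$ of length at least $\ell$ contains a product-one subsequence of length exactly $|G|$. *)

(* Defs.v *)
From mathcomp Require Import all_boot all_fingroup cyclic.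
From mathcomp Require Import finmap multiset boolp.

Set Implicit Arguments.
Unset Strict Implicit.
Unset Printing Implicit Defensive.

Local Open Scope group_scope.
Local Open Scope nat_scope.
Local Open Scope mset_scope.

Section Sequences.
Variable gT : finGroupType.
Implicit Types (G : {group gT}) (S T : {mset gT}).

(* The length of [S] is [size S], the coercion of [S] to [seq gT] listing its
   terms with multiplicity; [#|S|] would count distinct terms only. *)

Definition sequence_over G S : Prop := {subset S <= G}.

Definition product_one S : Prop :=
  S <> mset0 /\
  exists s : seq gT, seq_mset s = S /\ (\prod_(x <- s) x = 1)%g.

Definition product_one_free S : Prop :=
  ~ exists T, (T `<=` S)%mset /\ product_one T.

Definition product_one_free_length G (l : nat) : Prop :=
  exists S, [/\ sequence_over G S, product_one_free S & size S = l].

Definition gao_length G (l : nat) : Prop :=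
  forall S, sequence_over G S -> l <= size S ->
    exists T, [/\ (T `<=` S)%mset, product_one T & size T = #|G|].

(* The next lemmas guarantee that the maximum defining [small_davenport] and
   the minimum defining [gao] exist. *)

Lemma product_one_free_length0 G : product_one_free_length G 0.
Proof.
exists mset0; split; first by move=> x; rewrite in_mset0.
  by case=> T []; rewrite msubset0 => /eqP -> [].
by rewrite enum_mset0.
Qed.

Lemma product_one_free_length_bound G l :
  product_one_free_length G l -> l <= #|G|.
Proof.
case=> S [SG freeS <-]; rewrite leqNgt; apply/negP => ltGS; apply: freeS.
set s : seq gT := S.
have sG x : x \in s -> x \in G by apply: SG.
pose P (i : 'I_(size s).+1) := (\prod_(x <- take i s) x)%g.
have /injectivePn [i [j neq_ij eqPij]] : ~~ injectiveb P.
  apply/negP => /injectiveP injP.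
  suff : #|codom P| <= #|G|.
    by rewrite (card_codom injP) card_ord leqNgt ltnS ltnW.
  apply/subset_leq_card/fintype.subsetP => _ /codomP [i ->].
  rewrite /P big_seq; apply: group_prod => x /mem_take; exact: sG.
wlog lt_ij : i j neq_ij eqPij / i < j.
  move=> W; have := neq_ij; rewrite -val_eqE neq_ltn => /orP [] ?.
    exact: (W i j).
  by apply: (W j i) => //; rewrite eq_sym.
pose t := drop i (take j s).
have size_t : size t = j - i by rewrite size_drop size_takel // -ltnS.
have take_cat : take j s = take i s ++ t.
  by rewrite -[LHS](cat_take_drop i) take_takel // ltnW.
exists (seq_mset t); split.
  apply/msubsetP => x; rewrite mset_seqE -count_mem_mset -/s.
  rewrite -[in leqRHS](cat_take_drop j s) take_cat !count_cat.
  by rewrite addnAC leq_addl.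
split; last first.
  exists t; split=> //; apply: (mulgI (P i)).
  by rewrite mulg1 [RHS]eqPij /P take_cat big_cat.
move=> t0; have := perm_size (perm_eq_seq_mset t).
by rewrite t0 enum_mset0 size_t => /eqP; rewrite eq_sym subn_eq0 leqNgt lt_ij.
Qed.

Lemma gao_length_exists G : gao_length G (#|G| * #|G|).
Proof.
move=> S SG leS.
have [g gG leg] : exists2 g, g \in G & #|G| <= S g.
  apply: contrapT => noG.
  have ltS g : g \in G -> S g <= #|G|.-1.
    move=> gG; rewrite -ltnS prednK ?cardG_gt0 // ltnNge.
    by apply/negP => leg; apply: noG; exists g.
  suff : size S <= #|G| * #|G|.-1.
    move/(leq_trans leS); rewrite leq_pmul2l ?cardG_gt0 //.
    by rewrite leqNgt prednK ?cardG_gt0 // leqnn.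
  have -> : size S = \sum_(g in G) S g.
    under eq_bigr do rewrite -count_mem_mset.
    under eq_bigr do rewrite -sum1_count.
    rewrite -sum1_size (exchange_big_dep predT) //=.
    apply: eq_big_seq => x xS; rewrite (bigD1 x) ?SG //= ?eqxx //.
    rewrite big1 // => g /andP[/andP[_ /eqP eq_xg]].
    by rewrite eq_xg eqxx.
  by rewrite -sum_nat_const; apply: leq_sum.
exists (msetn #|G| g); split.
- by apply/msubsetP => x; rewrite msetnE; case: eqP => // ->.
- split=> [/(congr1 (fun A : {mset gT} => A g))|].
    by rewrite msetnxx mset0E; apply/eqP; rewrite -lt0n cardG_gt0.
  exists (nseq #|G| g); split; first by rewrite -enum_msetn seq_mset_id.
  rewrite big_nseq iter_mulg_1; apply/eqP; rewrite -order_dvdn.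
  exact: order_dvdG.
- by rewrite enum_msetn size_nseq.
Qed.

Fact small_davenport_ex G : exists l, `[< product_one_free_length G l >].
Proof. by exists 0; apply/asboolP/product_one_free_length0. Qed.

Fact small_davenport_ub G l : `[< product_one_free_length G l >] -> l <= #|G|.
Proof. by move/asboolP/product_one_free_length_bound. Qed.

Fact gao_ex G : exists l, `[< gao_length G l >].
Proof. by exists (#|G| * #|G|); apply/asboolP/gao_length_exists. Qed.

Definition small_davenport G : nat :=
  ex_maxn (small_davenport_ex G) (@small_davenport_ub G).

Definition gao G : nat := ex_minn (gao_ex G).

End Sequences.

(* Main.v *)
Require Import Defs.
From mathcomp Require Import all_boot all_fingroup.
From mathcomp Require Import all_algebra all_solvable ring zify.
From mathcomp Require Import finmap multiset boolp.

Set Implicit Arguments.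
Unset Strict Implicit.
Unset Printing Implicit Defensive.

(** The inequality [d(G) + |G| <= E(G)] holds for every finite group: adding
    [|G| - 1] copies of the identity to a longest product-one free sequence
    leaves no product-one subsequence of length [|G|]
    ([davenport_add_card_le_gao]).

    The other inequality rests on a polynomial method over the field with [p]
    elements. Call a function on sequences of degree less than [n] when [n]
    successive differences, each comparing a sequence with the one obtained by
    prepending a term, annihilate it. If [f] has degree less than the length of
    [s] and does not vanish at the empty sequence, then it does not vanish at
    some nonempty subsequence of [s] ([deg_lt_nonzero]). Binomial coefficients
    give functions of degree less than [p ^ e] whose nonvanishing at [u] forces
    [p ^ e %| u]; products of them express that a subsequence has product one
    and length divisible by [p ^ 3]. A sequence over [G] of length [p ^ 3 + n],
    with [n < p ^ 3], then has a product-one subsequence of length exactly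
    [p ^ 3] as soon as product-one is detected in degree [n].

    A group of order [p ^ 3] is of one of three kinds.
    - It is cyclic: one exponent modulo [p ^ 3] detects the identity, so
      [n = p ^ 3 - 1].
    - It is not cyclic and has an element [a] of order [p ^ 2]. With [b] outside
      [<[a]>], every element is some [b ^+ j * a ^+ i], and the exponents of a
      product are twisted sums of those of the factors. The twist depends on the
      exponents of [b] modulo [p] only, and it does not raise the degree
      ([deg_lt_twisted]); so [n = p ^ 2 + p - 2].
    - All elements have order dividing [p]. If [G] is abelian, three exponents
      modulo [p] give [n = 3 * (p - 1)].
    In each case [davenport_extend], applied along a chain of normal subgroups,
    gives a product-one free sequence of length [n], whence [n <= d(G)] and
    [E(G) <= |G| + n <= |G| + d(G)] ([gao_eq]).

    There remains the nonabelian group of exponent [p], where [p > 2] and the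
    noncommutativity has to be used. Choose an abelian subgroup [A] of order
    [p ^ 2] containing the center [Z] and treat the three exponents as if they
    were additive. They are so modulo [Z] and on [A]; hence a sequence of length
    [p ^ 3 + 3 * (p - 1)] has a subsequence [t] of length [p ^ 3] whose product
    is central, and is [1] if [t] lies in [A] ([elementary_linear]). If [t] has
    [p - 1] terms in one coset [g Z] and a term [u] not commuting with [g],
    moving [u] past these terms one at a time multiplies the product by the
    powers of a generator of [Z], so that one of the orderings has product [1]
    ([noncommuting_product_one]). When many terms of the sequence are
    noncentral, a suitable choice of [A] always brings one of these two
    arguments to bear ([noncentral_has_product_one]). When few are, some central
    element has a large multiplicity; translating it to the identity, one
    completes a product-one subsequence of nearly the right length by identities
    ([central_has_product_one]). *)

(** * Functions of bounded degree on sequences *)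

Section DegreeCalculus.
Import GRing.Theory.
Local Open Scope ring_scope.

Section AnyRing.
Variables (T : Type) (R : comNzRingType).
Implicit Types (f h : seq T -> R) (m n : nat).

(** [deg_lt n f] says that [f] has degree less than [n] for the difference
    operators that prepend a term; [deg_lt 0] is the zero function. Reading the
    sequence [g :: s] as the product of [g] by that of [s], these are the left
    translations of a group, and the definition is dual to the vanishing of
    [n]-fold products in its augmentation ideal. *)
Fixpoint deg_lt n f : Prop :=
  if n is n'.+1 then forall g, deg_lt n' (fun s => f (g :: s) - f s)
  else forall s, f s = 0.

Lemma eq_deg_lt n f h : f =1 h -> deg_lt n f -> deg_lt n h.
Proof.
elim: n f h => [|n IHn] f h fh /=; first by move=> f0 s; rewrite -fh.
by move=> df g; apply: IHn (df g) => s; rewrite !fh.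
Qed.

Lemma deg_ltS n f : deg_lt n f -> deg_lt n.+1 f.
Proof.
elim: n f => [|n IHn] f /= df g; last by apply: IHn; apply: df.
by move=> s; rewrite !df subrr.
Qed.

Lemma deg_ltW m n f : (m <= n)%N -> deg_lt m f -> deg_lt n f.
Proof.
by move/subnKC <-; elim: (n - m)%N => [|k IHk] df; rewrite ?addn0 // addnS;
  apply/deg_ltS/IHk.
Qed.

Lemma deg_lt0 n : deg_lt n (fun=> 0).
Proof. exact: (@deg_ltW 0). Qed.

Lemma deg_lt_cst c : deg_lt 1 (fun=> c).
Proof. by move=> g s /=; rewrite subrr. Qed.

Lemma deg_ltD n f h :
  deg_lt n f -> deg_lt n h -> deg_lt n (fun s => f s + h s).
Proof.
elim: n f h => [|n IHn] f h /= df dh; first by move=> s; rewrite df dh addr0.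
by move=> g; apply: eq_deg_lt (IHn _ _ (df g) (dh g)) => s; ring.
Qed.

Lemma deg_lt_sum I (r : seq I) (P : pred I) n (f : I -> seq T -> R) :
    (forall i, P i -> deg_lt n (f i)) ->
  deg_lt n (fun s => \sum_(i <- r | P i) f i s).
Proof.
move=> df; elim: r => [|i r IHr].
  by apply: eq_deg_lt (deg_lt0 n) => s; rewrite big_nil.
have [Pi|nPi] := boolP (P i).
  by apply: eq_deg_lt (deg_ltD (df i Pi) IHr) => s; rewrite big_cons Pi.
by apply: eq_deg_lt IHr => s; rewrite big_cons (negPf nPi).
Qed.

(** A discrete Leibniz rule: the difference of [f * h] is
    [Df * h + f * Dh + Df * Dh]. In terms of degrees, which are one less than
    the bounds, it says that degrees add up; the truncated predecessor also
    covers the case where a factor is zero. *)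
Lemma deg_ltM m n f h :
  deg_lt m f -> deg_lt n h -> deg_lt (m + n).-1 (fun s => f s * h s).
Proof.
have [k] := ubnP (m + n)%N; elim: k m n f h =>
  // k IHk [|m] [|n] f h lt_k df dh.
- by apply: eq_deg_lt (deg_lt0 _) => s; rewrite df mul0r.
- by apply: eq_deg_lt (deg_lt0 _) => s; rewrite df mul0r.
- by apply: eq_deg_lt (deg_lt0 _) => s; rewrite dh mulr0.
rewrite addSn addnS /= => g.
have d1 := IHk m n.+1 _ _ ltac:(lia) (df g) dh.
have d2 := IHk m.+1 n _ _ ltac:(lia) df (dh g).
have d3 := IHk m n _ _ ltac:(lia) (df g) (dh g).
rewrite addnS in d1; rewrite addSn in d2.
have d3' := deg_ltW (leq_pred _) d3.
by apply: eq_deg_lt (deg_ltD (deg_ltD d1 d2) d3') => s; ring.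
Qed.

Lemma deg_lt_exp m n f :
  deg_lt m.+1 f -> deg_lt (m * n).+1 (fun s => f s ^+ n).
Proof.
move=> df; elim: n => [|n IHn]; first by rewrite muln0; apply: deg_lt_cst.
have -> : (m * n.+1).+1 = (m.+1 + (m * n).+1).-1 by lia.
have dM := deg_ltM df IHn.
by apply: eq_deg_lt dM => s; rewrite exprS.
Qed.

End AnyRing.

(** If [f] vanished at all nonempty subsequences of [s], the iterated difference
    of [f] along the terms of [s], which is zero for degree reasons, would be [f
    [::]] up to sign. *)
Lemma deg_lt_nonzero (T : eqType) (R : comNzRingType) (f : seq T -> R) s :
    deg_lt (size s) f -> f [::] != 0 ->
  exists t, [/\ subseq t s, t != [::] & f t != 0].
Proof.
elim: s f => [|g s IHs] f /= df f0; first by rewrite df eqxx in f0.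
have [h0|/(IHs _ (df g))] := eqVneq (f [:: g] - f [::]) 0.
  exists [:: g]; split=> //=; first by rewrite eqxx sub0seq.
  by move/eqP: h0; rewrite subr_eq0 => /eqP->.
case=> t [ts t0 fgt]; have [ft0|ft] := eqVneq (f t) 0.
  by exists (g :: t); split=> //=; rewrite ?eqxx //; rewrite ft0 subr0 in fgt.
by exists t; split=> //; apply: subseq_trans ts (subseq_cons _ _).
Qed.

Section Binomials.
Variables (T : Type) (R : comNzRingType).

(** Prepending [g] changes [u] by [d g], and by Vandermonde's identity it
    changes ['C(u, k)] by the sum of the ['C(d g, w) * 'C(u, k - w)] for
    [0 < w <= k]. The increment [d g] may depend on the sequence, provided that
    each ['C(d g, w)] has degree less than [w], so that the lower order of the
    other factor is not lost. *)
Lemma deg_lt_bin k (u : seq T -> nat) (d : T -> seq T -> nat) :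
    (forall g s, u (g :: s) = (u s + d g s)%N) ->
    (forall g w, (0 < w <= k)%N ->
       deg_lt w (fun s => ('C(d g s, w))%:R : R)) ->
  deg_lt k.+1 (fun s => ('C(u s, k))%:R : R).
Proof.
move=> uE; elim/ltn_ind: k => k IHk dd g.
pose D (w : 'I_k) s : R := ('C(d g s, w.+1))%:R * ('C(u s, k - w.+1))%:R.
have dD w : true -> deg_lt k (D w).
  move=> _; have lt_wk := ltn_ord w.
  have dk : deg_lt (k - w.+1).+1 (fun s => ('C(u s, k - w.+1))%:R : R).
    apply: IHk => [|g' w' /andP[w0 ww]]; first lia.
    by apply: dd; rewrite w0; lia.
  have := deg_ltM (dd g w.+1 ltac:(lia)) dk.
  by apply: deg_ltW; lia.
apply: eq_deg_lt (deg_lt_sum (index_enum _) dD) => s.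
rewrite uE addnC -binomial.Vandermonde big_ord_recl /= bin0 mul1n subn0 natrD
  addrC addKr.
by rewrite natr_sum; apply: eq_bigr => w _; rewrite /D -natrM.
Qed.

Lemma deg_lt_bin_sum k (w : T -> nat) c :
  deg_lt k.+1 (fun s => ('C(c + \sum_(x <- s) w x, k))%:R : R).
Proof.
apply: (@deg_lt_bin _ _ (fun g _ => w g)) => [g s|g i /andP[i0 _]].
  by rewrite big_cons addnAC addnA.
exact: (deg_ltW i0 (@deg_lt_cst T R _)).
Qed.

End Binomials.

End DegreeCalculus.

(** * Binomial coefficients modulo a prime *)

Section ModP.
Variables (p : nat) (p_prime : prime p).

(** With [q = p ^ e] and [n = q.-1 + u], the identity
    [u * 'C(n, u) = q * 'C(n, u.-1)] shows that [q] divides [u] whenever [p]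
    does not divide ['C(n, u) = 'C(n, q.-1)]. *)
Lemma dvd_of_bin e u :
  ~~ (p %| 'C((p ^ e).-1 + u, (p ^ e).-1)) -> p ^ e %| u.
Proof.
case: u => [|u] ndvd; first by rewrite dvdn0.
have q0 : 0 < p ^ e by rewrite expn_gt0 prime_gt0.
set n := (p ^ e).-1 + u.+1 in ndvd *.
have En : 'C(n, (p ^ e).-1) = 'C(n, u.+1).
  by rewrite -bin_sub /n ?leq_addr // addKn.
have := mul_bin_left n u; have -> : n - u = p ^ e by rewrite /n; lia.
rewrite -En => E; rewrite -(@Gauss_dvdl _ _ 'C(n, (p ^ e).-1)) ?E ?dvdn_mulr //.
by rewrite coprimeXl // prime_coprime.
Qed.

Lemma dvd_bin_pmul e m w : 0 < w < p ^ e -> p %| 'C(p ^ e * m, w).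
Proof.
case: w => // w /andP[_ lt_w]; apply: contraTT lt_w => ndvd.
rewrite -leqNgt dvdn_leq // -(@Gauss_dvdl _ _ 'C(p ^ e * m, w.+1)).
  by rewrite -mul_bin_diag -mulnA dvdn_mulr.
by rewrite coprimeXl // prime_coprime.
Qed.

(** By Vandermonde's identity, since [p] divides ['C(p ^ e * m, w)] for
    [0 < w < p ^ e]. *)
Lemma bin_periodic e d d' w :
  w < p ^ e -> d = d' %[mod p ^ e] -> 'C(d, w) = 'C(d', w) %[mod p].
Proof.
move=> lt_w; wlog: d d' / d <= d' => [W|le_dd].
  have [|/ltnW le_dd] := leqP d d'; first exact: W.
  by move/esym/(W _ _ le_dd)/esym.
move/eqP; rewrite eq_sym eqn_mod_dvd // => /dvdnP[m Em].
rewrite -(subnK le_dd) Em mulnC -binomial.Vandermonde big_ord_recl /= bin0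
  mul1n subn0.
rewrite -modnDmr -[in LHS](addn0 'C(d, w)); congr ((_ + _) %% p).
apply/esym/eqP; rewrite -/(p %| _) dvdn_sum // => i _; apply: dvdn_mulr.
by apply: dvd_bin_pmul; rewrite /= /bump /=; have := ltn_ord i; lia.
Qed.

Import GRing.Theory.
Local Open Scope ring_scope.

Lemma natFp_eq m n : (m%:R == n%:R :> 'F_p) = (m == n %[mod p]).
Proof.
wlog le_mn : m n / (n <= m)%N => [W|].
  have [|/ltnW] := leqP n m => /W; first by [].
  by rewrite eq_sym => ->; rewrite eq_sym.
rewrite -subr_eq0 -natrB // -(dvdn_pcharf (pchar_Fp p_prime)).
by rewrite eqn_mod_dvd.
Qed.

Lemma natFp_fermat n : (n%:R : 'F_p) ^+ p.-1 = (~~ (p %| n)%N)%:R.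
Proof.
have p1 := prime_gt1 p_prime.
have [pn|npn] /= := boolP (p %| n)%N.
  move: pn; rewrite (dvdn_pcharf (pchar_Fp p_prime)) => /eqP ->.
  by rewrite expr0n; case: (p) p1 => [|[]].
apply/eqP; rewrite -subr_eq0.
have n0 : n%:R != 0 :> 'F_p by rewrite -(dvdn_pcharf (pchar_Fp p_prime)).
rewrite -(mulrI_eq0 _ (mulfI n0)) mulrBr mulr1 -exprS prednK ?prime_gt0 //.
rewrite subr_eq0 -natrX natFp_eq; exact/eqP/fermat_little.
Qed.

(** Any [p]-periodic function of [j] is the polynomial of degree [p.-1]
    interpolating it, [\sum_(v < p) h v * (1 - (j - v) ^+ p.-1)]. *)
Lemma deg_lt_periodic (T : Type) (w : T -> nat) (h : nat -> 'F_p) :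
    (forall m n, m = n %[mod p] -> h m = h n) ->
  deg_lt p (fun s : seq T => h (\sum_(x <- s) w x)%N).
Proof.
move=> hE; have p0 := prime_gt0 p_prime.
pose f (v : 'I_p) (s : seq T) : 'F_p :=
  (* the binomial coefficient is just [j - v], written without subtraction *)
  h v * (1 - ('C(p - v + \sum_(x <- s) w x, 1))%:R ^+ p.-1).
have df v : true -> deg_lt p (f v).
  move=> _; have Ep : p = (1 + p.-1.+1).-1 by lia.
  have d1 := deg_ltW (ltn0Sn p.-1) (@deg_lt_cst T 'F_p 1).
  have d2 := deg_lt_exp p.-1 (@deg_lt_bin_sum T 'F_p 1 w (p - v)).
  have := deg_ltM (@deg_lt_cst T 'F_p (-1)) d2; rewrite mul1n -Ep => dm.
  rewrite prednK // in d1; rewrite [p in deg_lt p]Ep.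
  apply: deg_ltM (deg_lt_cst _) _; rewrite prednK //.
  by apply: eq_deg_lt (deg_ltD d1 dm) => s; rewrite mulN1r.
apply: eq_deg_lt (deg_lt_sum (index_enum _) df) => s.
set j := (\sum_(x <- s) w x)%N.
have lt_j : (j %% p < p)%N by rewrite ltn_mod.
rewrite (bigD1 (Ordinal lt_j)) //= big1 ?addr0 => [|v nv].
  rewrite /f bin1 natFp_fermat /=; have -> : (p %| p - j %% p + j)%N.
    by rewrite /dvdn -modnDmr subnK ?modnn // ltnW.
  by rewrite subr0 mulr1; apply: hE; rewrite modn_mod.
rewrite /f bin1 natFp_fermat; suff -> : (p %| p - v + j)%N = false.
  by rewrite subrr mulr0.
apply: contraNF nv => dv; rewrite -val_eqE /= eq_sym.
have lt_v := ltn_ord v.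
have : v + (p - v + j) == v + 0 %[mod p] by rewrite eqn_modDl mod0n.
rewrite addnA subnKC ?(ltnW lt_v) // modnDl addn0 => /eqP ->.
by rewrite modn_small.
Qed.

End ModP.

(** * Zero-sum subsequences over abelian p-groups *)

Section ZeroSum.
Variables (p : nat) (p_prime : prime p).
Import GRing.Theory.
Local Open Scope ring_scope.

(** The shift by [(p ^ e).-1] makes this [1] at [0] and zero unless [p ^ e]
    divides [u]. *)
Definition dvd_test e u : 'F_p := ('C((p ^ e).-1 + u, (p ^ e).-1))%:R.

Lemma dvd_test0 e : dvd_test e 0 = 1.
Proof. by rewrite /dvd_test addn0 binn. Qed.

Lemma dvd_testP e u : dvd_test e u != 0 -> (p ^ e %| u)%N.
Proof.
by rewrite -(dvdn_pcharf (pchar_Fp p_prime)); apply: dvd_of_bin.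
Qed.

Lemma deg_lt_dvd_test T (w : T -> nat) e :
  deg_lt (p ^ e) (fun s => dvd_test e (\sum_(x <- s) w x)%N).
Proof.
rewrite -[(p ^ e)%N]prednK ?expn_gt0 ?prime_gt0 //.
exact: deg_lt_bin_sum.
Qed.

(** Olson's theorem on the Davenport constant of an abelian [p]-group, the group
    being presented by the residues of the weights [we.1] modulo [p ^ we.2]. *)
Lemma zero_sum_subseq (T : eqType) (ws : seq ((T -> nat) * nat)) (s : seq T) :
    (\sum_(we <- ws) (p ^ we.2).-1 < size s)%N ->
  exists t, [/\ subseq t s, t != [::] &
    all (fun we => p ^ we.2 %| \sum_(x <- t) we.1 x)%N ws].
Proof.
move=> lt_s; pose f t := \prod_(we <- ws) dvd_test we.2 (\sum_(x <- t) we.1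
  x)%N.
have df : deg_lt (size s) f.
  apply: deg_ltW lt_s _; rewrite {}/f; elim: ws => [|[w e] ws IHws].
    by rewrite big_nil; apply: eq_deg_lt (@deg_lt_cst T _ 1) => t;
      rewrite big_nil.
  have q0 : (0 < p ^ e)%N by rewrite expn_gt0 prime_gt0.
  have := deg_ltM (deg_lt_dvd_test w e) IHws.
  rewrite big_cons /=; have ->
    : ((p ^ e + (\sum_(we <- ws) (p ^ we.2).-1).+1).-1 =
    ((p ^ e).-1 + \sum_(we <- ws) (p ^ we.2).-1).+1)%N by lia.
  by move=> d; apply: eq_deg_lt d => t; rewrite big_cons.
have f0 : f [::] != 0.
  rewrite /f big1 ?oner_neq0 // => we _.
  by rewrite big_nil dvd_test0.
have [t [ts t0 ft]] := deg_lt_nonzero df f0.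
exists t; split=> //; apply/allP => we we_ws; apply: dvd_testP.
by apply: contra_neq ft => f_we; rewrite /f (big_rem we) //= f_we mul0r.
Qed.

End ZeroSum.

(** * The constants in terms of lists *)

Section Sequences.
Variable gT : finGroupType.
Implicit Types (G H N : {group gT}) (s t r : seq gT).

Definition free_seq s :=
  forall t r, perm_eq (t ++ r) s -> (\prod_(x <- t) x = 1)%g -> t = [::].

Definition has_product_one n s :=
  exists t r, [/\ perm_eq (t ++ r) s, size t = n & (\prod_(x <- t) x = 1)%g].

Lemma perm_has_product_one n s s' :
  perm_eq s s' -> has_product_one n s -> has_product_one n s'.
Proof.
by move=> ss' [t [r [str nt t1]]]; exists t, r; split=> //;
  apply: perm_trans ss'.
Qed.

Lemma sub_has_product_one n s r :
  has_product_one n s -> has_product_one n (s ++ r).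
Proof.
case=> t [r' [str nt t1]]; exists t, (r' ++ r); split=> //.
by rewrite catA perm_cat2r.
Qed.

Lemma msubset_seqP s t :
  (seq_mset t `<=` seq_mset s)%mset <-> exists r, perm_eq (t ++ r) s.
Proof.
split=> [/msubsetP ts|[r str]].
  have /count_subseqP [t' /perm_to_subseq [r srt] tt'] :
    forall x, count_mem x t <= count_mem x s.
    by move=> x; rewrite -!mset_seqE.
  by exists r; rewrite perm_sym (permPl srt) perm_cat2r perm_sym.
by apply/msubsetP => x; rewrite !mset_seqE -(seq.permP str) count_cat leq_addr.
Qed.

Lemma size_seq_mset s : size (seq_mset s) = size s.
Proof. exact: perm_size (perm_eq_seq_mset s). Qed.

Lemma seq_mset_eq0 s : seq_mset s = mset0 -> s = [::].
Proof. by move=> s0; apply: size0nil; rewrite -size_seq_mset s0 enum_mset0. Qed.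

Lemma seq_mset_over G s : {subset s <= G} <-> sequence_over G (seq_mset s).
Proof.
by split=> sG x; have := perm_mem (perm_eq_seq_mset s) x => xs xin; apply: sG;
  rewrite ?xs // -xs.
Qed.

Lemma free_seqP s : free_seq s <-> product_one_free (seq_mset s).
Proof.
split=> [free_s [T [Ts [T0 [t [tT t1]]]]]|free_s t r str t1].
  rewrite -{}tT in Ts T0; have /msubset_seqP [r str] := Ts.
  by apply: T0; rewrite (free_s _ _ str t1); apply/msetP => x;
    rewrite mset_seqE mset0E.
apply: contrapT => /eqP t0; apply: free_s; exists (seq_mset t); split.
  by apply/msubset_seqP; exists r.
by split; [move/seq_mset_eq0/eqP; apply/negP | exists t].
Qed.

Lemma free_seq_size G s : {subset s <= G} -> free_seq s ->
  size s <= small_davenport G.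
Proof.
move=> sG free_s; rewrite /small_davenport; case: ex_maxnP => d _; apply.
apply/asboolP; exists (seq_mset s); split; last exact: size_seq_mset.
  exact: (seq_mset_over _ _).1.
exact: (free_seqP _).1.
Qed.

Lemma free_seq_exists G :
  exists s, [/\ {subset s <= G}, free_seq s & size s = small_davenport G].
Proof.
rewrite /small_davenport; case: ex_maxnP => d /asboolP [S [SG freeS <-]] _.
exists (S : seq gT); split=> //.
by apply: (free_seqP _).2; rewrite seq_mset_id.
Qed.

Lemma gao_le G n :
    (forall s, {subset s <= G} -> size s = n -> has_product_one #|G| s) ->
  gao G <= n.
Proof.
move=> one_n; rewrite /gao; case: ex_minnP => m _; apply.
apply/asboolP => S SG le_n.
have [x /mem_take||t [r [str st t1]]] := one_n (take n S);
  [exact: SG|exact: size_takel|].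
exists (seq_mset t); split.
- rewrite -[S in (_ `<=` S)%mset]seq_mset_id; apply/msubset_seqP.
  by exists (r ++ drop n S);
    rewrite catA -[X in perm_eq _ X](cat_take_drop n) perm_cat2r.
- split; last by exists t.
  by move/seq_mset_eq0 => t0; have := cardG_gt0 G; rewrite -st t0.
- by rewrite size_seq_mset.
Qed.

Lemma gao_ge G n :
    (exists s, [/\ {subset s <= G}, size s = n & ~ has_product_one #|G| s]) ->
  n < gao G.
Proof.
case=> s [sG ns no1]; rewrite /gao; case: ex_minnP => m /asboolP gao_m _.
rewrite ltnNge; apply/negP => le_mn; apply: no1.
have [||T [Ts [_ [t [tT t1]]] sT]] := gao_m (seq_mset s).
- exact: (seq_mset_over _ _).1.
- by rewrite size_seq_mset ns.
rewrite -{}tT in Ts sT.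
have /msubset_seqP [r str] := Ts.
by exists t, r; split; rewrite // -size_seq_mset.
Qed.

Lemma davenport_add_card_le_gao G : small_davenport G + #|G| <= gao G.
Proof.
have G0 := cardG_gt0 G; rewrite -(prednK G0) addnS; apply: gao_ge.
have [s [sG free_s <-]] := free_seq_exists G.
exists (s ++ nseq #|G|.-1 1%g); split.
- move=> x; rewrite mem_cat => /orP [/sG //|]; rewrite mem_nseq.
  by case/andP=> _ /eqP->.
- by rewrite size_cat size_nseq.
case=> t [r [str st t1]].
pose t' := [seq x <- t | x != 1%g].
have t'1 : (\prod_(x <- t') x = 1)%g.
  rewrite big_filter big_mkcond -[RHS]t1; apply: eq_bigr => x _.
  by case: eqVneq.
have le_ts x : count_mem x t <= count_mem x s + (1%g == x) * #|G|.-1.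
  have := seq.permP str (pred1 x); rewrite !count_cat count_nseq /= => <-.
  exact: leq_addr.
have [|r' st'r] := (msubset_seqP s t').1.
  apply/msubsetP => x; rewrite !mset_seqE count_filter.
  have [->|nx] := eqVneq x 1%g.
    by rewrite (@eq_count _ _ pred0) ?count_pred0 // => y /=; case: eqVneq.
  apply: leq_trans (leq_trans (le_ts x) _); last first.
    by rewrite eq_sym (negPf nx) mul0n addn0.
  by apply: sub_count => y /andP [].
have t'0 := free_s _ _ st'r t'1.
have t_one : count_mem 1%g t = #|G|.
  rewrite -st -(count_predC (pred1 1%g)); have ->
    : count (predC (pred1 1%g)) t = 0.
    by rewrite -size_filter -[filter _ _]/t' t'0.
  by rewrite addn0.
have s_one : count_mem 1%g s = 0.
  apply/count_memPn/negP => /perm_to_rem s1.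
  by have := free_s [:: 1%g] (rem 1%g s); rewrite perm_sym big_seq1 =>
    /(_ s1 erefl).
(* so [t] would consist of [|G|] copies of [1], one more than there are *)
have := le_ts 1%g; rewrite t_one s_one eqxx mul1n; lia.
Qed.

(** If [x] has order at least [n] modulo the normal subgroup [N], then [n.-1]
    copies of [x] can be added to a product-one free sequence over [N]: modulo
    [N] a product of terms only remembers how many copies of [x] it uses. *)
Lemma davenport_extend N H (x : gT) n :
    (N <| H)%g -> x \in H -> (forall k, 0 < k < n -> (x ^+ k)%g \notin N) ->
  small_davenport N + n.-1 <= small_davenport H.
Proof.
move=> nNH xH xN; have [s [sN free_s <-]] := free_seq_exists N.
rewrite -(size_nseq n.-1 x) -size_cat; apply: free_seq_size => [y|].
  rewrite mem_cat mem_nseq => /orP [/sN|/andP[_ /eqP-> //]].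
  exact/subsetP/normal_sub.
move=> t r str t1.
have memt y : y \in t -> y \in N \/ y = x.
  move=> yt; have : y \in s ++ nseq n.-1 x by rewrite -(perm_mem str) mem_cat
    yt.
  by rewrite mem_cat mem_nseq => /orP [/sN|/andP[_ /eqP]]; [left|right].
have xnN : n.-1 = 0 \/ x \notin N.
  by case: (n) xN => [|[|m]] xN; [left|left|right; rewrite -(expg1 x) xN].
have nxN : (x \in 'N(N))%g by apply: subsetP xH; apply: normal_norm.
have le_t : count (fun y => y \notin N) t <= n.-1.
  apply: leq_trans (_ : count (fun y => y \notin N) (s ++ nseq n.-1 x) <= _).
    by rewrite -(seq.permP str) count_cat leq_addr.
  rewrite count_cat (@eq_in_count _ _ pred0) ?count_pred0 => [|y /sN /= ->] //.
  by rewrite add0n count_nseq; case: (x \notin N); rewrite ?mul1n.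
have prodE : (coset N (\prod_(y <- t) y) = coset N x ^+ count (fun y =>
  y \notin N) t)%g.
  have : forall y, y \in t -> (y \in 'N(N))%g.
    by move=> y /memt [yN|-> //]; apply: subsetP yN; apply: normG.
  elim: t memt {str t1 le_t} => [|y t IHt] memt nt;
    first by rewrite big_nil morph1.
  have nt' : forall z, z \in t -> (z \in 'N(N))%g by move=> z zt;
    rewrite nt // inE zt orbT.
  have ny : (y \in 'N(N))%g by rewrite nt ?mem_head.
  have nprod : (\prod_(z <- t) z \in 'N(N))%g.
    by rewrite big_seq; apply: (@group_prod _ 'N(N)%G) => z /nt'.
  rewrite big_cons (morphM (coset_morphism N) ny nprod) /=.
  rewrite IHt //; last by move=> z zt; apply: memt; rewrite inE zt orbT.
  rewrite /=; case: (boolP (y \in N)) => yN /=.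
    by rewrite coset_id // mul1g.
  case: (memt y (mem_head _ _)) => [|->]; first by rewrite (negPf yN).
  by rewrite add1n expgS.
have c0 : count (fun y => y \notin N) t = 0.
  apply/eqP; rewrite -leqn0 leqNgt; apply/negP => c_gt0.
  have /negP[] := xN (count (fun y => y \notin N) t) ltac:(lia).
  apply: coset_idr; first exact: groupX.
  by rewrite (morphX (coset_morphism N)) //= -prodE t1 morph1.
have tN : filter (mem N) t = t.
  apply/all_filterP/allP => y yt; apply/negPn/negP => yN.
  move/eqP: c0; apply/negP; rewrite -lt0n -has_count.
  by apply/hasP; exists y.
apply: (free_s t (filter (mem N) r)) => //.
have := perm_filter (mem N) str; rewrite !filter_cat tN.
have -> : filter (mem N) s = s by apply/all_filterP/allP => y /sN.
rewrite filter_nseq /=; have -> : (x \in N) * n.-1 = 0 by case: xnN =>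
  [->|/negPf->]; rewrite ?muln0.
by rewrite cats0.
Qed.

End Sequences.

(** * Groups with a large cyclic subgroup *)

Lemma dvdn_lt_double_eq q n m :
  q %| n -> 0 < n -> n <= q + m -> m < q -> n = q.
Proof. by case/dvdnP=> [[|[|k]]] ->; rewrite ?mul1n // => _; nia. Qed.

Section Prime.
Variables (p : nat) (p_prime : prime p).

(** Adding the weight [1] modulo [p ^ 3] to the others makes the length of the
    subsequence a multiple of [p ^ 3]; there is room for only one multiple. *)
Lemma zero_sum_length (T : eqType) (ws : seq ((T -> nat) * nat)) (s : seq T) :
    size s = p ^ 3 + \sum_(we <- ws) (p ^ we.2).-1 ->
    \sum_(we <- ws) (p ^ we.2).-1 < p ^ 3 ->
  exists t r, [/\ perm_eq (t ++ r) s, size t = p ^ 3 &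
    all (fun we => p ^ we.2 %| \sum_(x <- t) we.1 x) ws].
Proof.
move=> ns lt_ws; have q0 : 0 < p ^ 3 by rewrite expn_gt0 prime_gt0.
have [|t [ts t0 /=]] := @zero_sum_subseq p p_prime T ((fun=> 1, 3) :: ws) s.
  by rewrite big_cons ns /=; lia.
rewrite sum1_size => /andP [dvd_t all_t].
have [r srt] := perm_to_subseq ts; exists t, r; split=> //.
  by rewrite perm_sym.
apply: dvdn_lt_double_eq dvd_t _ _ lt_ws; first by rewrite lt0n size_eq0.
by rewrite -ns size_subseq.
Qed.

End Prime.

Section Groups.
Variable gT : finGroupType.
Implicit Types (G H : {group gT}) (s t r : seq gT).
Local Open Scope group_scope.

Lemma gao_eq G n :
    n <= small_davenport G ->
    (forall s, {subset s <= G} -> size s = (#|G| + n)%N ->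
       has_product_one #|G| s) ->
  gao G = (small_davenport G + #|G|)%N.
Proof.
move=> le_nd one_n; apply/eqP; rewrite eqn_leq davenport_add_card_le_gao andbT.
apply: gao_le => s sG ns; rewrite -(cat_take_drop (#|G| + n) s).
apply: sub_has_product_one; apply: one_n => [x /mem_take /sG //|].
by rewrite size_takel // ns addnC leq_add2r.
Qed.

Lemma prod_expg (a : gT) (w : gT -> nat) t :
    (forall x, x \in t -> x = a ^+ w x) ->
  \prod_(x <- t) x = a ^+ (\sum_(x <- t) w x)%N.
Proof.
elim: t => [|x t IHt] tE; first by rewrite !big_nil.
rewrite !big_cons expgD -tE ?mem_head // IHt // => y yt.
by rewrite -tE // inE yt orbT.
Qed.

Section Prime.
Variables (p : nat) (p_prime : prime p).

Lemma gao_cyclic_p3 G :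
  #|G| = (p ^ 3)%N -> cyclic G -> gao G = (small_davenport G + #|G|)%N.
Proof.
move=> oG /cyclicP [a Ga]; have oa : #[a] = (p ^ 3)%N by rewrite -oG Ga.
have q0 : 0 < p ^ 3 by rewrite expn_gt0 prime_gt0.
apply: (@gao_eq _ (p ^ 3).-1) => [|s sG].
  apply: leq_trans (@davenport_extend _ 1 G a (p ^ 3)%N _ _ _);
    first exact: leq_addl.
  - exact: normal1.
  - by rewrite Ga cycle_id.
  - by move=> k k_lt; rewrite inE -order_dvdn oa gtnNdvd //; case/andP: k_lt.
have /boolp.choice [w wE] : forall g, exists k, g \in G -> g = a ^+ k.
  by move=> g; rewrite Ga; case: (boolP (g \in _)) => [/cycleP [i ->]|_];
    [exists i | exists 0%N].
rewrite oG => ns; have [||t [r [str nt]]] :=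
  @zero_sum_length _ p_prime _ [:: (w, 3)] s.
- by rewrite big_seq1.
- by rewrite big_seq1 /=; lia.
rewrite /= andbT => dvd_t; exists t, r; split=> //.
rewrite (prod_expg (a := a) (w := w)); last first.
  by move=> x xt; apply: wE; apply: sG; rewrite -(perm_mem str) mem_cat xt.
by apply/eqP; rewrite -order_dvdn oa.
Qed.

(** In this section every element of [G] is some [b ^+ j * a ^+ i], where
    conjugation by [b] raises [a] to the power [r]. It models all noncyclic
    groups of order [p ^ 3] with an element of order [p ^ 2], abelian or not,
    the quaternion group included: that is why [b ^+ p] is only required to be a
    power of [a ^+ p]. *)
Section Metacyclic.
Variables (G : {group gT}) (a b : gT) (i j : gT -> nat) (r c : nat).
Hypotheses (a_p2 : a ^+ (p ^ 2) = 1)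
  (b_p : b ^+ p = a ^+ (p * c)) (ab : a * b = b * a ^+ r)
  (r_p : r ^ p = 1 %[mod p ^ 2])
  (GE : forall g, g \in G -> g = b ^+ j g * a ^+ i g).

(** The exponent of [a] in a product: moving [a ^+ i g] to the right past the
    power of [b] contributed by the later factors multiplies it by a power of
    [r]. *)
Fixpoint twisted_sum t :=
  if t is g :: t' then i g * r ^ (\sum_(x <- t') j x) + twisted_sum t' else 0.

Lemma twisted_commute m n : a ^+ m * b ^+ n = b ^+ n * a ^+ (m * r ^ n).
Proof.
elim: n m => [|n IHn] m; first by rewrite expn0 muln1 mulg1 mul1g.
rewrite expgS mulgA expnS mulnA.
have -> : a ^+ m * b = b * a ^+ (m * r).
  elim: m => [|m IHm]; first by rewrite mul1g mulg1.
  by rewrite expgS -mulgA IHm mulgA ab -mulgA -expgD mulSn.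
by rewrite -mulgA IHn mulgA.
Qed.

Lemma twisted_prod t : {subset t <= G} ->
  \prod_(x <- t) x = b ^+ (\sum_(x <- t) j x)%N * a ^+ twisted_sum t.
Proof.
elim: t => [|g t IHt] tG; first by rewrite !big_nil mulg1.
rewrite !big_cons IHt => [|x xt]; last by apply: tG; rewrite inE xt orbT.
rewrite {1}(GE (tG _ (mem_head _ _))) -!mulgA (mulgA (a ^+ _)) twisted_commute.
by rewrite !expgD !mulgA.
Qed.

(** When [p] divides the exponent [J] of [b], the relation
    [b ^+ p = a ^+ (p * c)] turns [b ^+ J] into [a ^+ (c * J)]. *)
Lemma twisted_prod_eq1 t : {subset t <= G} -> p %| \sum_(x <- t) j x ->
  p ^ 2 %| twisted_sum t + c * \sum_(x <- t) j x -> \prod_(x <- t) x = 1.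
Proof.
move=> tG /dvdnP [m jE] /dvdnP [n E]; rewrite twisted_prod //.
have -> : b ^+ (\sum_(x <- t) j x)%N = a ^+ (c * \sum_(x <- t) j x)%N.
  by rewrite jE mulnC expgM b_p -expgM; congr (_ ^+ _); lia.
by rewrite -expgD addnC E mulnC expgM a_p2 expg1n.
Qed.

(** Prepending [g] increases the tested quantity by [d = i g * r ^ J + c * j g],
    where [J] is the sum of the exponents of [b]. For [w < p], ['C(d, w)] only
    depends on [d] modulo [p], and not on [J] because [r = 1] modulo [p]. For
    [p <= w < p ^ 2] it depends on [d] modulo [p ^ 2], hence on [J] modulo [p],
    and has degree less than [p <= w]. So the degree is the one that it would
    have for [r = 1]. *)
Lemma deg_lt_twisted :
  deg_lt (p ^ 2)
    (fun t => dvd_test p 2 (twisted_sum t + c * \sum_(x <- t) j x)).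
Proof.
have p1 := prime_gt1 p_prime; have q0 : 0 < p ^ 2 by rewrite expn_gt0 ltnW.
have r1 : r = 1 %[mod p].
  have p_p2 : p %| p ^ 2 by rewrite dvdn_exp.
  by rewrite -(fermat_little r p_prime) -(modn_dvdm _ p_p2) r_p modn_dvdm.
rewrite -[X in deg_lt X]prednK //.
apply: (@deg_lt_bin _ _ _ _ (fun g t =>
  i g * r ^ (\sum_(x <- t) j x) + c * j g)%N).
  by move=> g t; rewrite big_cons /=; lia.
move=> g w /andP [w0 le_w].
pose h m : 'F_p := ('C(i g * r ^ m + c * j g, w))%:R%R.
have [lt_wp|le_pw] := ltnP w p.
  apply: deg_ltW w0 _; apply: eq_deg_lt (@deg_lt_cst gT 'F_p (h 0)) => t.
  apply/eqP; rewrite natFp_eq //; apply/eqP.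
  apply: (bin_periodic p_prime (e := 1)); rewrite ?expn1 //.
  rewrite -modnDml -[in RHS]modnDml; congr ((_ + _) %% p).
  have rk k : r ^ k = 1 %[mod p] by rewrite -modnXm r1 modnXm exp1n.
  by rewrite -modnMmr -[in RHS]modnMmr !rk.
apply: deg_ltW le_pw _; apply: (@deg_lt_periodic p p_prime gT j h _) => m n mn.
apply/eqP; rewrite natFp_eq //; apply/eqP.
apply: (bin_periodic p_prime (e := 2)); first by rewrite -(prednK q0) ltnS.
rewrite -modnDml -[in RHS]modnDml; congr ((_ + _) %% _)%N.
rewrite -modnMmr -[in RHS]modnMmr; congr ((_ * _) %% _)%N.
have red k : r ^ k = r ^ (k %% p) %[mod p ^ 2].
  rewrite {1}(divn_eq k p) expnD mulnC expnM -modnMmr.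
  have -> : (r ^ (k %/ p)) ^ p = 1 %[mod p ^ 2].
    by rewrite -expnM mulnC expnM -modnXm r_p modnXm exp1n.
  by rewrite modnMmr muln1.
by rewrite red mn -red.
Qed.

Lemma metacyclic_product_one s : {subset s <= G} ->
  size s = (p ^ 3 + (p ^ 2 + p - 2))%N -> has_product_one (p ^ 3) s.
Proof.
have p1 := prime_gt1 p_prime; move=> sG ns.
pose f t := (dvd_test p 3 (\sum_(x <- t) 1) *
  (dvd_test p 1 (\sum_(x <- t) j x) *
   dvd_test p 2 (twisted_sum t + c * \sum_(x <- t) j x)))%R.
have df : deg_lt (size s) f.
  have d1 := deg_lt_dvd_test p_prime (fun=> 1%N) 3 (T := gT).
  have d2 := deg_lt_dvd_test p_prime j 1.
  apply: deg_ltW (deg_ltM d1 (deg_ltM d2 deg_lt_twisted)).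
  by rewrite ns expn1; move: p1; clear; nia.
have [|t [ts t0 ft]] := deg_lt_nonzero df.
  by rewrite /f /= !big_nil muln0 !dvd_test0 !GRing.mulr1 GRing.oner_neq0.
have [t_r srt] := perm_to_subseq ts; exists t, t_r.
have tG : {subset t <= G} by move=> x /(mem_subseq ts)/sG.
move: ft; rewrite !GRing.mulf_eq0 !negb_or => /and3P [].
move=> /(dvd_testP p_prime) f1 /(dvd_testP p_prime) f2 /(dvd_testP p_prime) f3.
split; first by rewrite perm_sym.
  rewrite sum1_size in f1; apply: (dvdn_lt_double_eq (m :=
    (p ^ 2 + p - 2)%N) f1).
  - by rewrite lt0n size_eq0.
  - by rewrite -ns size_subseq.
  - by move: p1; clear; nia.
by apply: twisted_prod_eq1 => //; rewrite expn1 in f2.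
Qed.

End Metacyclic.
End Prime.
End Groups.

(** * Sequences with many central terms *)

Section Central.
Variable gT : finGroupType.
Implicit Types (G H K Z : {group gT}) (s t r : seq gT).
Local Open Scope group_scope.

Lemma count_pigeonhole (T : Type) (J : finType) (P : pred T) (Q : pred J)
    (f : T -> J) k (t : seq T) :
    (forall x, P x -> Q (f x)) -> #|Q| * k < count P t ->
  exists2 j, Q j & k < count (fun x => P x && (f x == j)) t.
Proof.
move=> PQ lt_k; apply: contrapT => no_j; move: lt_k; rewrite ltnNge => /negP;
  apply.
rewrite -sum1_count (partition_big f Q) //= -sum_nat_const.
apply: leq_sum => j Qj; rewrite sum1_count leqNgt; apply/negP => lt_j.
by apply: no_j; exists j.
Qed.

Lemma prod_in (hT : finGroupType) (H : {group hT}) (t : seq hT) :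
  {subset t <= H} -> \prod_(x <- t) x \in H.
Proof. by move=> tG; rewrite big_seq; apply: group_prod. Qed.

Lemma perm_prod_abelian (hT : finGroupType) (H : {group hT}) (t t' : seq hT) :
    abelian H -> {subset t <= H} -> perm_eq t t' ->
  \prod_(x <- t) x = \prod_(x <- t') x.
Proof.
move=> cHH; elim: t t' => [|x t IHt] t' tH.
  by rewrite perm_sym => /perm_nilP->.
move=> xtt'; have xt' : x \in t' by rewrite -(perm_mem xtt') mem_head.
case/splitPr: xt' xtt' => p1 p2;
  rewrite perm_sym -cat1s perm_catCA /= perm_cons perm_sym.
move=> tp; have tH' : {subset t <= H} by move=> y yt; rewrite tH // inE yt orbT.
rewrite big_cons (IHt _ tH' tp) !big_cat big_cons /= !mulgA; congr (_ * _).
apply: (centsP cHH); first by rewrite tH ?mem_head.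
by apply: prod_in => y yp; apply: tH'; rewrite (perm_mem tp) mem_cat yp.
Qed.

Lemma prod_coset K t : {subset t <= 'N(K)} ->
  coset K (\prod_(x <- t) x) = \prod_(x <- map (coset K) t) x.
Proof.
move=> tN; rewrite big_map !big_seq.
by rewrite (morph_prod (coset_morphism K)).
Qed.

Lemma perm_prod_mod G K t t' :
    K <| G -> abelian (G / K) -> {subset t <= G} -> perm_eq t t' ->
  (\prod_(x <- t) x \in K) = (\prod_(x <- t') x \in K).
Proof.
move=> nKG cGK tG tt'; have t'G : {subset t' <= G}.
  by move=> x; rewrite -(perm_mem tt') => /tG.
have nG r : {subset r <= G} -> {subset r <= 'N(K)}.
  by move=> rG x /rG; apply: subsetP; apply: normal_norm.
have inK r : {subset r <= G} ->
    (\prod_(x <- r) x \in K) = (\prod_(x <- map (coset K) r) x == 1).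
  move=> rG; rewrite -prod_coset; last exact: nG.
  apply/idP/eqP => [|c1]; first exact: coset_id.
  by apply: coset_idr c1; apply: prod_in; apply: nG.
rewrite !inK //; congr (_ == _); apply: (perm_prod_abelian cGK).
  by move=> _ /mapP [x /tG xG ->]; apply: mem_quotient.
exact: perm_map.
Qed.

Lemma perm_size_cat s t r : perm_eq (t ++ r) s -> (size t + size r)%N = size s.
Proof. by move/perm_size; rewrite size_cat. Qed.

Definition nb_in (A : {set gT}) s := count (mem A) s.
Definition nb_out (A : {set gT}) s := count (predC (mem A)) s.

Lemma nb_in_out (A : {set gT}) s : (nb_in A s + nb_out A s)%N = size s.
Proof. exact: count_predC. Qed.

Lemma nb_in_cat (A : {set gT}) s t r :
  perm_eq (t ++ r) s -> (nb_in A t + nb_in A r)%N = nb_in A s.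
Proof. by move/seq.permP/(_ (mem A)); rewrite count_cat. Qed.

Lemma nb_out_cat (A : {set gT}) s t r :
  perm_eq (t ++ r) s -> (nb_out A t + nb_out A r)%N = nb_out A s.
Proof. by move/seq.permP/(_ (predC (mem A))); rewrite count_cat. Qed.

Lemma nb_in_all (A : {set gT}) s : {subset s <= A} -> nb_in A s = size s.
Proof. by move=> sA; apply/eqP; rewrite -all_count; apply/allP. Qed.

Lemma nb_inI (A B : {set gT}) s :
  (nb_in A s + nb_in B s <= size s + nb_in (A :&: B) s)%N.
Proof.
rewrite /nb_in -count_predUI leq_add ?count_size //.
by apply: sub_count => x /andP [xA xB]; apply/setIP.
Qed.

Lemma free_seq_remainder G s : {subset s <= G} ->
  exists p r, [/\ perm_eq (p ++ r) s,
    \prod_(x <- p) x = 1 & size r <= small_davenport G].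
Proof.
have [n] := ubnP (size s); elim: n s => // n IHn s lt_n sG.
have [free_s|not_free] := pselect (free_seq s).
  by exists [::], s; rewrite big_nil; split; rewrite ?free_seq_size.
have [t [r [str t1 t0]]] : exists t r,
    [/\ perm_eq (t ++ r) s, \prod_(x <- t) x = 1 & t <> [::]].
  apply: contrapT => no_t; apply: not_free => t r str t1; apply: contrapT => t0.
  by apply: no_t; exists t, r.
have sz := perm_size_cat str.
have [||p [r' [rpr p1 r'd]]] := IHn r.
- by case: (t) t0 sz => //= *; lia.
- by move=> x xr; apply: sG; rewrite -(perm_mem str) mem_cat xr orbT.
exists (t ++ p), r'; split=> //; last by rewrite big_cat t1 p1 /= mulg1.
by apply: perm_trans str; rewrite -catA perm_cat2l.
Qed.

Lemma prod_central_split G Z t : Z \subset 'Z(G) -> {subset t <= G} ->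
  \prod_(x <- t) x =
  \prod_(x <- filter (predC (mem Z)) t) x * \prod_(x <- filter (mem Z) t) x.
Proof.
move=> ZG; elim: t => [|x t IHt] tG; first by rewrite !big_nil mulg1.
have tG' : {subset t <= G} by move=> y yt; rewrite tG // inE yt orbT.
rewrite big_cons IHt //=; case: (boolP (x \in Z)) => xZ /=;
  rewrite !big_cons ?mulgA //.
congr (_ * _); have /centerP [_ cxG] := subsetP ZG x xZ; apply: cxG.
by apply: prod_in => y; rewrite mem_filter => /andP [_ /tG'].
Qed.

(** The bound [d(Z) <= |Z|] already applies to the first [|Z|.+1] terms of [q],
    and this keeps the block small. *)
Lemma central_block Z q : {subset q <= Z} -> #|Z| < size q ->
  exists B r, [/\ perm_eq (B ++ r) q, \prod_(x <- B) x = 1, B <> [::] &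
    size B <= #|Z|.+1].
Proof.
move=> qZ lt_q; pose q1 : seq gT := take #|Z|.+1 q.
have sz_q1 : size q1 = #|Z|.+1 by rewrite size_takel.
have q1Z : {subset q1 <= Z} by move=> x /mem_take /qZ.
have not_free : ~ free_seq q1.
  move=> free_q1; have := free_seq_size q1Z free_q1; rewrite sz_q1 ltnNge.
  rewrite /small_davenport; case: ex_maxnP => d /asboolP dZ _.
  by rewrite (product_one_free_length_bound dZ).
apply: contrapT => no_B; apply: not_free => B r Bq1 B1; apply: contrapT => B0.
apply: no_B; exists B, (r ++ drop #|Z|.+1 q); split=> //.
  by rewrite catA -[X in perm_eq _ X](cat_take_drop #|Z|.+1) perm_cat2r.
by rewrite -sz_q1 -(perm_size Bq1) size_cat leq_addr.
Qed.

(** Let [h] be the number of terms equal to [1]. A product-one subsequence [p]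
    of the other terms, chosen so that their remainder is product-one free, has
    length at least [|G| - h]. As long as [p] is longer than [|G|], it has more
    than [|Z|] terms in [Z], so a product-one block of at most [|Z|.+1 <= h.+1]
    terms of [Z] can be removed from it; being central, the block does not
    disturb the product of the rest. The length thus enters the interval from
    [|G| - h] to [|G|], and copies of [1] make up the difference. *)
Lemma central_one_has_product_one G Z s :
    Z \subset 'Z(G) -> {subset s <= G} ->
    size s = (small_davenport G + #|G|)%N ->
    #|Z| <= count_mem 1 s -> nb_out Z s + #|Z| <= #|G| ->
  has_product_one #|G| s.
Proof.
move=> ZG sG ns; set h := count_mem 1 s => le_h le_nc.
pose s1 : seq gT := filter (predC (pred1 1)) s.
have ss1 : perm_eq (nseq h 1 ++ s1) s.
  have sE : perm_eq (filter (pred1 1) s ++ s1) s by rewrite perm_filterC.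
  rewrite -(permPr sE) perm_cat2r; suff ->
    : filter (pred1 1) s = nseq h 1 by [].
  by rewrite /h -size_filter; apply/all_pred1P/filter_all.
have s1G : {subset s1 <= G} by move=> x; rewrite mem_filter => /andP [_ /sG].
have sz : (h + size s1 = small_davenport G + #|G|)%N.
  by rewrite -ns -(perm_size ss1) size_cat size_nseq.
suff [p [r [prs1 p1 /andP [le_p p_le]]]] : exists p r,
    [/\ perm_eq (p ++ r) s1, \prod_(x <- p) x = 1 & #|G| <= h + size p <= h +
      #|G|].
  rewrite leq_add2l in p_le; pose m := (#|G| - size p)%N.
  exists (p ++ nseq m 1), (nseq (h - m) 1 ++ r); split.
  - rewrite -(permPr ss1) -catA perm_sym perm_catC.
    rewrite -(permPl (perm_cat prs1 (perm_refl _))) -catA perm_cat2l catA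
      -nseqD.
    by rewrite subnKC 1?perm_catC // /m; lia.
  - by rewrite size_cat size_nseq subnKC.
  - by rewrite big_cat p1 /= mul1g big_nseq iter_mulg_1 expg1n.
have [p [r [prs1 p1 r_le]]] := free_seq_remainder s1G.
have le_p : #|G| <= h + size p.
  by have := perm_size_cat prs1; lia.
have [n] := ubnP (size p); elim: n p r prs1 p1 le_p {r_le} =>
  // n IHn p r prs1 p1 le_p lt_n.
have [p_le|p_gt] := leqP (size p) #|G|.
  by exists p, r; rewrite le_p leq_add2l.
have pG : {subset p <= G}.
  by move=> x xp; apply: s1G; rewrite -(perm_mem prs1) mem_cat xp.
pose q : seq gT := filter (mem Z) p; pose q' : seq gT :=
  filter (predC (mem Z)) p.
have qZ : {subset q <= Z} by move=> x; rewrite mem_filter => /andP [].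
have ppq : perm_eq p (q' ++ q).
  by rewrite perm_sym perm_catC perm_filterC.
have q'_le : size q' <= nb_out Z s.
  rewrite /nb_out -(seq.permP ss1) count_cat -(seq.permP prs1) count_cat
    size_filter.
  by rewrite addnCA leq_addr.
have szpq : (size q' + size q)%N = size p by apply: perm_size_cat;
  rewrite perm_sym.
have lt_q : #|Z| < size q.
  by lia.
have [B [r' [Br'q B1 B0 B_le]]] := central_block qZ lt_q.
have szB : 0 < size B by case: (B) B0.
have szq := perm_size_cat Br'q.
apply: (IHn (q' ++ r') (B ++ r)).
- rewrite -(permPr prs1) -catA.
  rewrite (permPr (perm_cat ppq (perm_refl r))) -catA perm_cat2l catA
    perm_cat2r.
  by rewrite perm_catC.
- have cZZ : abelian Z by apply: abelianS ZG (center_abelian G).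
  have r'q : \prod_(x <- q) x = \prod_(x <- r') x.
    by rewrite (perm_prod_abelian cZZ qZ (_ : perm_eq q (B ++ r'))) ?big_cat
      ?B1 /= ?mul1g // perm_sym.
  by rewrite big_cat -r'q; exact: etrans (esym (prod_central_split ZG pG)) p1.
- by rewrite size_cat; lia.
- by rewrite size_cat; lia.
Qed.

(** Some [z] in [Z] occurs at least [|Z|] times. Dividing all terms by the
    central element [z] changes a product of [|G|] terms by [z ^+ #|G| = 1], so
    [z] may be taken to be [1]. *)
Lemma central_has_product_one G Z s :
    Z \subset 'Z(G) -> {subset s <= G} ->
    size s = (small_davenport G + #|G|)%N ->
    #|Z| * #|Z|.-1 < nb_in Z s -> nb_out Z s + #|Z| <= #|G| ->
  has_product_one #|G| s.
Proof.
move=> ZG sG ns lt_s le_nc.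
have [//|z zZ lt_z] := count_pigeonhole (f := id) (Q := mem Z) _ lt_s.
have ZsG : Z \subset G by apply: subset_trans ZG (center_sub G).
have zG : z \in G := subsetP ZsG z zZ.
have cz x : x \in G -> z * x = x * z.
  by have /centerP [_] := subsetP ZG z zZ; apply.
pose s' : seq gT := map (mulg z^-1) s.
have ss' : s = map (mulg z) s'.
  by rewrite -map_comp map_id_in // => x _ /=; rewrite mulKVg.
have [t [r [str nt t1]]] : has_product_one #|G| s'.
{ apply: (central_one_has_product_one ZG).
  - by move=> _ /mapP [x /sG xG ->]; rewrite groupM ?groupV.
  - by rewrite size_map.
  - rewrite count_map; apply: leq_trans (_ : count_mem z s <= _).
      apply: leq_trans (leq_trans _ lt_z) _; first by rewrite prednK.
      by apply: sub_count => x /andP [].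
    by apply: sub_count => x /eqP -> /=; rewrite mulVg.
  - rewrite /nb_out count_map; apply: leq_trans le_nc; rewrite leq_add2r.
    by apply: sub_count => x /=; apply: contra => xZ; rewrite groupM ?groupV. }
exists (map (mulg z) t), (map (mulg z) r); split.
- by rewrite -map_cat [X in perm_eq _ X]ss' perm_map.
- by rewrite size_map.
have tG : {subset t <= G}.
  move=> x xt; have : x \in s' by rewrite -(perm_mem str) mem_cat xt.
  by case/mapP=> y /sG yG ->; rewrite groupM ?groupV.
have -> : \prod_(x <- map (mulg z) t) x = z ^+ size t * \prod_(x <- t) x.
  elim: t tG {str nt t1} => [|x t IHt] tG; first by rewrite !big_nil mulg1.
  have tG' : {subset t <= G} by move=> y yt; rewrite tG // inE yt orbT.
  have xG : x \in G by rewrite tG ?mem_head.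
  rewrite /= !big_cons IHt // expgS -!mulgA; congr (_ * _); rewrite !mulgA.
  by congr (_ * _); apply: commuteX; apply/esym/cz.
by rewrite t1 nt mulg1; apply/eqP; rewrite -order_dvdn order_dvdG.
Qed.

End Central.

(** * Subgroups of prime index *)

Section PrimeIndex.
Variable gT : finGroupType.
Implicit Types (A G H K Z : {group gT}) (s t r : seq gT).
Local Open Scope group_scope.

Section Prime.
Variables (p : nat) (p_prime : prime p).

Lemma prime_index_quotient G A b :
    A <| G -> #|G : A| = p -> b \in G -> b \notin A ->
  [/\ b ^+ p \in A, (forall k, 0 < k < p -> b ^+ k \notin A) &
      (forall g, g \in G -> exists j, exists2 x, x \in A & g = b ^+ j * x)].
Proof.
move=> nAG iGA bG bA; have bN : b \in 'N(A) by apply: subsetP bG;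
  apply: normal_norm.
have oQ : #|G / A| = p by rewrite card_quotient ?normal_norm.
have cbG : coset A b \in G / A by apply: mem_quotient.
have cb1 : coset A b != 1 by apply: contra bA => /eqP; apply: coset_idr.
have ocb : #[coset A b] = p.
  have := order_dvdG cbG; rewrite oQ => /(prime_nt_dvdP p_prime); apply.
  by rewrite order_eq1.
have inA k : (b ^+ k \in A) = (p %| k).
  rewrite -ocb order_dvdn -(morphX (coset_morphism A)) //=.
  apply/idP/eqP => [|c1]; first exact: coset_id.
  by apply: coset_idr c1; apply: groupX.
split=> [|k /andP [k0 kp]|g gG]; rewrite ?inA //; first by rewrite gtnNdvd.
have cE : <[coset A b]> = G / A.
  by apply/eqP; rewrite eqEcard cycle_subG cbG oQ -orderE ocb leqnn.
have : coset A g \in <[coset A b]> by rewrite cE mem_quotient.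
case/cycleP=> j gj; exists j, (b ^- j * g); last by rewrite mulKVg.
have gN : g \in 'N(A) by apply: subsetP gG; apply: normal_norm.
apply: coset_idr; first by rewrite groupM ?groupV ?groupX.
rewrite (morphM (coset_morphism A)) ?groupV ?groupX //=.
by rewrite (morphV (coset_morphism A)) ?groupX //= (morphX (coset_morphism A))
  //= gj mulVg.
Qed.

Lemma prime_index_normal G A :
  #|G| = (p ^ 3)%N -> A \subset G -> #|A| = (p ^ 2)%N -> A <| G /\ #|G : A| = p.
Proof.
move=> oG sAG oA; have iGA : #|G : A| = p.
  by rewrite -divgS // oG oA expnS mulnK // expn_gt0 prime_gt0.
have pG : p.-group G by rewrite /pgroup oG pnatX pnat_id.
by split=> //; apply: p_maximal_normal pG _; apply: p_index_maximal;
  rewrite ?iGA.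
Qed.

Lemma not_subset_card G A :
  A \subset G -> #|A| < #|G| -> exists2 b, b \in G & b \notin A.
Proof.
move=> sAG ltAG; apply/subsetPn; apply: contraL ltAG => sGA.
by rewrite -leqNgt subset_leq_card.
Qed.

(** Any [b] outside the normal subgroup [<[a]>] of index [p] provides the
    presentation studied above. As [G] is not cyclic, [b] has order at most
    [p ^ 2], which makes [b ^+ p] a power of [a ^+ p]; and [b ^+ p] commutes
    with [a], which gives [r ^ p = 1] modulo [p ^ 2]. The sequence of
    [(p ^ 2).-1] copies of [a] and [p.-1] copies of [b] is product-one free. *)
Lemma gao_order_p2 G a :
    #|G| = (p ^ 3)%N -> ~~ cyclic G -> a \in G -> #[a] = (p ^ 2)%N ->
  gao G = (small_davenport G + #|G|)%N.
Proof.
move=> oG ncG aG oa; have p1 := prime_gt1 p_prime.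
have sAG : <[a]> \subset G by rewrite cycle_subG.
have [nAG iGA] := prime_index_normal oG sAG oa.
have [|b bG bA] := not_subset_card sAG;
  first by rewrite oG -orderE oa ltn_exp2l.
have [bpA bkA GE] := prime_index_quotient nAG iGA bG bA.
have aN : a ^ b \in <[a]>.
  by rewrite memJ_norm ?cycle_id //; apply: subsetP bG; apply: normal_norm.
have /cycleP [r ar] := aN; have /cycleP [u bpu] := bpA.
have ab : a * b = b * a ^+ r by rewrite -ar conjgC.
have a_p2 : a ^+ (p ^ 2) = 1 by rewrite -oa expg_order.
have b_p2 : b ^+ (p ^ 2) = 1.
  have /(dvdn_pfactor _ _ p_prime) [m m3 ob] : #[b] %| p ^ 3 by rewrite -oG
    order_dvdG.
  apply/eqP; rewrite -order_dvdn ob dvdn_exp2l // -ltnS ltn_neqAle m3 andbT.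
  apply: contra ncG => /eqP m_3; apply/cyclicP; exists b; apply/eqP.
  by rewrite eq_sym eqEcard cycle_subG bG -orderE ob m_3 oG leqnn.
have [c uc] : exists c, u = (p * c)%N.
  suff /dvdnP [c ->] : p %| u by exists c; rewrite mulnC.
  have : a ^+ (u * p) == 1 by rewrite expgM -bpu -expgM mulnn b_p2.
  by rewrite -order_dvdn oa expnS dvdn_pmul2r ?prime_gt0.
have r_p : r ^ p = 1 %[mod p ^ 2].
  have cE := twisted_commute (b := b) (r := r) ab 1 p.
  have : a ^+ (1 * r ^ p) == a ^+ 1.
    apply/eqP/(mulgI (b ^+ p)); rewrite -cE expg1 bpu.
    by rewrite -expgSr -expgS.
  by rewrite eq_expg_mod_order oa mul1n => /eqP.
have /boolp.choice [ji jiE] : forall g, exists ji : nat * nat, g \in G ->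
  g = b ^+ ji.1 * a ^+ ji.2.
  move=> g; have [/GE [j [x /cycleP [i ->] gE]]|ngG] := boolP (g \in G).
    by exists (j, i).
  by exists (0%N, 0%N).
have d_ge : p ^ 2 + p - 2 <= small_davenport G.
  have d1 : (p ^ 2).-1 <= small_davenport <[a]>.
    apply: leq_trans (@davenport_extend _ 1 <[a]> a (p ^ 2)%N _ _ _);
      first exact: leq_addl.
    - exact: normal1.
    - exact: cycle_id.
    - by move=> k k_lt; rewrite inE -order_dvdn oa gtnNdvd //; case/andP: k_lt.
  have -> : (p ^ 2 + p - 2 = (p ^ 2).-1 + p.-1)%N by move: p1; clear; nia.
  apply: leq_trans (davenport_extend nAG bG bkA).
  by rewrite leq_add2r.
apply: (gao_eq d_ge) => s sG; rewrite oG => ns; rewrite uc in bpu.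
exact: (metacyclic_product_one p_prime a_p2 bpu ab r_p jiE).
Qed.

End Prime.
End PrimeIndex.

(** * Groups of exponent p *)

Section GroupsP3.
Variable gT : finGroupType.
Implicit Types (A G H K Z : {group gT}) (s t r : seq gT).
Local Open Scope group_scope.

Variables (p : nat) (p_prime : prime p).

Lemma prod_move_past (u k : gT) vs :
    (forall v, v \in vs -> v * u = u * v * k) ->
    (forall v, v \in vs -> commute k v) ->
  \prod_(v <- vs) v * u = u * \prod_(v <- vs) v * k ^+ size vs.
Proof.
elim: vs => [|v vs IHvs] vu kv; first by rewrite big_nil mul1g !mulg1.
rewrite big_cons -mulgA IHvs => [|w wv|w wv]; [|by apply: vu;
  rewrite inE wv orbT|by apply: kv; rewrite inE wv orbT].
have kP : commute k (\prod_(j <- vs) j).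
  elim: vs {IHvs vu} kv => [|w vs IHvs] kv; first by rewrite big_nil;
    apply: commute1.
  rewrite big_cons; apply: commuteM; first by apply: kv; rewrite !inE eqxx orbT.
  by apply: IHvs => v' v'v; apply: kv; move: v'v; rewrite !inE => /orP [->|->];
    rewrite ?orbT.
rewrite /= !mulgA vu ?mem_head // -!mulgA; congr (_ * (_ * _)).
by rewrite expgS !mulgA kP.
Qed.

(** Put [u] after the first [j] of [p.-1] terms lying in [g *: 'Z(G)]. Each of
    them contributes the same central commutator [k = [~ g, u] != 1] when it is
    exchanged with [u], so the product is [k ^+ j] times a fixed element of
    ['Z(G)]. For [j] from [0] to [p.-1] these are all the elements of ['Z(G)].
    *)
Lemma noncommuting_product_one G g u t :
    #|'Z(G)| = p -> abelian (G / 'Z(G)) -> {subset t <= G} ->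
    \prod_(x <- t) x \in 'Z(G) -> p.-1 <= count (mem (g *: 'Z(G))) t ->
    g \in G -> u \in t -> ~ commute g u ->
  exists2 t', perm_eq t' t & \prod_(x <- t') x = 1.
Proof.
move=> oZ cGZ tG tZ le_g gG ut ngu.
have uG := tG u ut; have nZG : 'Z(G) <| G := center_normal G.
pose k := [~ g, u].
have kZ : k \in 'Z(G) by apply: subsetP (mem_commg gG uG); apply: der1_min;
  rewrite ?normal_norm.
have kG : k \in G by apply: subsetP (center_sub G) k kZ.
have Zcomm z x : z \in 'Z(G) -> x \in G -> commute z x.
  by case/centerP=> _ cz xG; apply: cz.
have vu v : v \in g *: 'Z(G) -> v * u = u * v * k.
  case/lcosetP=> z zZ ->; rewrite -mulgA (Zcomm z u zZ uG) mulgA (commgC g u)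
    -/k.
  by rewrite -(mulgA _ k z) -(Zcomm z k zZ kG) !mulgA.
have ugZ : u \notin g *: 'Z(G).
  apply/negP => /vu uu; apply: ngu; apply/commgP/eqP.
  by apply: (mulgI (u * u)); rewrite mulg1 -uu.
pose t1 := rem u t; have tt1 : perm_eq t (u :: t1) := perm_to_rem ut.
pose f := filter (mem (g *: 'Z(G))) t1; pose vs := take p.-1 f.
pose rest := drop p.-1 f ++ filter (predC (mem (g *: 'Z(G)))) t1.
have sz_vs : size vs = p.-1.
  rewrite size_takel // size_filter; apply: leq_trans le_g _.
  by rewrite (seq.permP tt1) /= (negPf ugZ).
have vsgZ v : v \in vs -> v \in g *: 'Z(G).
  by move/mem_take; rewrite mem_filter => /andP [].
have t_perm : perm_eq (u :: vs ++ rest) t.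
  by rewrite (permPr tt1) perm_cons /rest catA cat_take_drop perm_filterC.
have gZG v : v \in g *: 'Z(G) -> v \in G.
  by case/lcosetP=> z zZ ->; rewrite groupM // (subsetP (center_sub G)).
(* the ordering of [t] in which [u] comes after [j] terms of the coset *)
pose tj j := take j vs ++ u :: drop j vs ++ rest.
have tj_perm j : perm_eq (tj j) t.
  rewrite -(permPr t_perm) /tj -cat1s perm_catCA /= perm_cons catA.
  by rewrite cat_take_drop.
have tj_prod j : j <= p.-1 ->
    \prod_(x <- tj j) x = \prod_(x <- u :: vs ++ rest) x * k ^+ j.
  move=> le_j; rewrite big_cat big_cons /= mulgA.
  rewrite (@prod_move_past u k) =>
    [|v /mem_take /vsgZ /vu //|v /mem_take /vsgZ /gZG]; last exact: Zcomm kZ.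
  have -> : \prod_(x <- u :: vs ++ rest) x =
      u * \prod_(v <- take j vs) v * \prod_(x <- drop j vs ++ rest) x.
    by rewrite big_cons -{1}(cat_take_drop j vs) -catA big_cat /= mulgA.
  rewrite size_takel ?sz_vs // -!mulgA; congr (_ * (_ * _)).
  apply: Zcomm; first exact: groupX.
  apply: prod_in => x xr; apply: tG; rewrite -(perm_mem t_perm) inE mem_cat.
  by move: xr; rewrite mem_cat => /orP [/mem_drop->|->]; rewrite ?orbT.
have k1 : k != 1 by apply/commgP.
have ok : #[k] = p.
  have := order_dvdG kZ; rewrite oZ => /(prime_nt_dvdP p_prime); apply.
  by rewrite order_eq1.
have kE : <[k]> = 'Z(G) by apply/eqP;
  rewrite eqEcard cycle_subG kZ -orderE ok oZ leqnn.
have t0Z : \prod_(x <- u :: vs ++ rest) x \in 'Z(G).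
  by rewrite (perm_prod_mod nZG cGZ _ t_perm) // => x;
    rewrite (perm_mem t_perm) => /tG.
have /cyclePmin [j lt_j jE] : (\prod_(x <- u :: vs ++ rest) x)^-1 \in <[k]>.
  by rewrite kE groupV.
rewrite ok in lt_j; exists (tj j); first exact: tj_perm.
by rewrite tj_prod -?jE ?mulgV // -ltnS prednK ?prime_gt0.
Qed.

Lemma commute_mulACA (hT : finGroupType) (x y z u : hT) :
  commute y z -> x * y * (z * u) = x * z * (y * u).
Proof. by move=> yz; rewrite -!mulgA; congr (_ * _); rewrite !mulgA yz. Qed.

(** Exponents add up in an abelian group; [f] will be a projection to an abelian
    quotient. *)
Lemma prod_coords (hT : finGroupType) (Q : {group hT}) (u v z : hT)
    (f : gT -> hT) (i j k : gT -> nat) t :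
    abelian Q -> u \in Q -> v \in Q -> z \in Q ->
    (forall g, g \in t -> f g = u ^+ i g * (v ^+ j g * z ^+ k g)) ->
  \prod_(g <- t) f g =
    u ^+ (\sum_(g <- t) i g)%N *
    (v ^+ (\sum_(g <- t) j g)%N * z ^+ (\sum_(g <- t) k g)%N).
Proof.
move=> cQQ uQ vQ zQ; have cQ x y : x \in Q -> y \in Q -> commute x y.
  by move=> xQ yQ; apply: (centsP cQQ).
elim: t => [|g t IHt] tE; first by rewrite !big_nil !mulg1.
rewrite !big_cons tE ?mem_head // IHt => [|h ht];
  last by rewrite tE // inE ht orbT.
rewrite commute_mulACA; last by apply: cQ; rewrite ?groupM ?groupX.
by rewrite (@commute_mulACA _ (v ^+ _)) ?expgD //; apply: cQ; rewrite groupX.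
Qed.

Lemma prod_coords_mod H K (b a c : gT) (y x w : gT -> nat) t :
    K <| H -> abelian (H / K) -> {subset t <= H} ->
    [/\ b \in H, a \in H & c \in H] -> [/\ b ^+ p = 1,
      a ^+ p = 1 & c ^+ p = 1] ->
    (forall g, g \in t -> g = b ^+ y g * (a ^+ x g * c ^+ w g)) ->
    [/\ p %| \sum_(g <- t) y g,
      p %| \sum_(g <- t) x g & p %| \sum_(g <- t) w g] ->
  \prod_(g <- t) g \in K.
Proof.
move=> nKH cHK tH [bH aH cH] [bp ap cp] tE [py px pw].
have inN (g : gT) : g \in H -> g \in 'N(K) by apply: subsetP;
  apply: normal_norm.
have tN : {subset t <= 'N(K)} by move=> g /tH /inN.
apply: coset_idr; first exact: prod_in.
rewrite prod_coset // big_map.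
rewrite (prod_coords (u := coset K b) (v := coset K a) (z := coset K c) (i :=
  y) (j := x)
  (k := w) cHK) ?mem_quotient // => [|g gt].
  have pE (g : gT) n : g \in H -> g ^+ p = 1 -> p %| n -> coset K g ^+ n = 1.
    move=> /inN gN gp /dvdnP [m ->]; rewrite mulnC expgM.
    by rewrite -(morphX (coset_morphism K)) //= gp morph1 expg1n.
  by rewrite !pE // !mulg1.
rewrite {1}(tE g gt) !(morphM (coset_morphism K)) ?groupM ?groupX ?inN //=.
by rewrite !(morphX (coset_morphism K)) ?inN.
Qed.

Section ExponentP.
Variables (G : {group gT}) (a c : gT).
Hypotheses (oG : #|G| = (p ^ 3)%N) (Gp : forall g, g \in G -> g ^+ p = 1)
  (cZ : c \in 'Z(G)) (c1 : c != 1) (aG : a \in G) (a_c : a \notin <[c]>).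

Let A := (<[c]> <*> <[a]>)%G.

Lemma order_exponent g : g \in G -> g != 1 -> #[g] = p.
Proof.
move=> gG g1; have : #[g] %| p by rewrite order_dvdn Gp.
by move/(prime_nt_dvdP p_prime); apply; rewrite order_eq1.
Qed.

Let cG : c \in G. Proof. exact: subsetP (center_sub G) c cZ. Qed.

Lemma cycle_cent : <[a]> \subset 'C(<[c]>).
Proof.
rewrite cent_cycle cycle_subG; apply/cent1P; have [_ cc] := centerP _ _ cZ.
by apply: commute_sym; apply: cc.
Qed.

Lemma elementary_facts :
  [/\ A \subset G, abelian A, #|A| = (p ^ 2)%N & A = <[c]> * <[a]> :> {set gT}].
Proof.
have AE : A = <[c]> * <[a]> :> {set gT} by rewrite /= cent_joinEr ?cycle_cent.
have oc := order_exponent cG c1.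
have a1 : a != 1 by apply: contraNneq a_c => ->; apply: group1.
have oa := order_exponent aG a1.
split=> //.
- by rewrite join_subG !cycle_subG cG.
- by rewrite abelianY !cycle_abelian cycle_cent.
rewrite AE TI_cardMg; first by rewrite -!orderE oc oa mulnn.
by rewrite setIC prime_TIg -?orderE ?oa // cycle_subG.
Qed.


Lemma elementary_basis : exists b (y x w : gT -> nat),
  [/\ b \in G, forall g, g \in A -> p %| y g,
      forall g, g \in G -> g = b ^+ y g * (a ^+ x g * c ^+ w g) &
      3 * p.-1 <= small_davenport G].
Proof.
have [sAG cAA oA AE] := elementary_facts; have p1 := prime_gt1 p_prime.
have [nAG iGA] := prime_index_normal p_prime oG sAG oA.
have [|b bG bA] := not_subset_card sAG; first by rewrite oG oA ltn_exp2l.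
have [bpA bkA GE] := prime_index_quotient p_prime nAG iGA bG bA.
have /boolp.choice [e eE] : forall g, exists e : nat * (nat * nat),
    g \in G -> g = b ^+ e.1 * (a ^+ e.2.1 * c ^+ e.2.2).
  move=> g; have [/GE [j [h hA gE]]|ngG] := boolP (g \in G); last first.
    by exists (0, (0, 0))%N.
  move: hA; rewrite AE => /mulsgP [_ _ /cycleP [n ->] /cycleP [m ->] hE].
  exists (j, (m, n)) => _; rewrite gE hE /=; congr (_ * _).
  have /centsP cca := cycle_cent.
  by apply/commute_sym/cca; rewrite mem_cycle.
exists b, (fun g => (e g).1), (fun g => (e g).2.1), (fun g => (e g).2.2);
  split=> //.
- move=> g gA; have gG := subsetP sAG g gA.
  have acA m n : a ^+ m * c ^+ n \in A.
    by rewrite groupM // groupX // mem_gen // inE cycle_id ?orbT.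
  have : b ^+ (e g).1 \in A by rewrite -(groupMr _ (acA (e g).2.1 (e g).2.2))
    -eE.
  rewrite -(expg_mod _ (Gp bG)).
  apply: contraTT; rewrite /dvdn -lt0n => r0.
  by apply: bkA; rewrite r0 ltn_mod prime_gt0.
have c_lt : p.-1 <= small_davenport <[c]>.
  apply: leq_trans (@davenport_extend _ 1 <[c]> c p _ _ _);
    first exact: leq_addl.
  - exact: normal1.
  - exact: cycle_id.
  - move=> k k_lt; rewrite inE -order_dvdn (order_exponent cG c1) gtnNdvd //.
      by case/andP: k_lt.
    by case/andP: k_lt.
have sCA : <[c]> \subset A by apply: joing_subl.
have nCA : <[c]> <| A by rewrite -sub_abelian_normal.
have iAC : #|A : <[c]>| = p.
  by rewrite -divgS // oA -orderE (order_exponent cG c1) expnS expn1 mulKn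
    ?prime_gt0.
have aA : a \in A by rewrite mem_gen // inE cycle_id orbT.
have [_ akc _] := prime_index_quotient p_prime nCA iAC aA a_c.
have -> : (3 * p.-1 = p.-1 + p.-1 + p.-1)%N by clear; lia.
apply: leq_trans (davenport_extend nAG bG bkA); rewrite leq_add2r.
by apply: leq_trans (davenport_extend nCA aA akc); rewrite leq_add2r.
Qed.

(** The exponents [y], [x], [w] of the basis [b], [a], [c] are treated as
    weights of an elementary abelian group of rank [3], although [G] need not be
    abelian. They are additive in every abelian quotient of [G], which yields
    the third clause, and on the abelian subgroup [A], where [y] is zero modulo
    [p], which yields the last one. *)
Lemma elementary_linear s : {subset s <= G} -> size s = (p ^ 3 + 3 * p.-1)%N ->
  exists t r, [/\ perm_eq (t ++ r) s, size t = (p ^ 3)%N,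
    forall K, K <| G -> abelian (G / K) -> \prod_(x <- t) x \in K &
    {subset t <= A} -> \prod_(x <- t) x = 1].
Proof.
have [sAG cAA oA AE] := elementary_facts; have p1 := prime_gt1 p_prime.
have [b [y [x [w [bG yA GE _]]]]] := elementary_basis.
move=> sG ns; have E : (\sum_(we <- [:: (y, 1); (x, 1); (w,
  1)]) (p ^ we.2).-1 = 3 * p.-1)%N.
  by rewrite !big_cons big_nil /= !expn1 addn0; clear; lia.
have [||t [r [str nt]]] := zero_sum_length p_prime (T := gT) (ws := [:: (y,
  1%N); (x, 1%N); (w, 1%N)]) (s := s).
- by rewrite E.
- by rewrite E; move: p1; clear; nia.
rewrite /= !expn1 andbT => /and3P [py px pw].
have tG : {subset t <= G} by move=> g gt; apply: sG;
  rewrite -(perm_mem str) mem_cat gt.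
have [bp ap cp] : [/\ b ^+ p = 1, a ^+ p = 1 & c ^+ p = 1] by split; apply: Gp.
exists t, r; split=> // [K nKG cGK|tA].
  apply: (prod_coords_mod (b := b) (a := a) (c := c) (y := y) (x := x) (w :=
    w) nKG cGK tG) => // g gt.
  by apply: GE; apply: tG.
have aA : a \in A by rewrite mem_gen // inE cycle_id orbT.
have cA : c \in A by rewrite mem_gen // inE cycle_id.
apply/set1P; apply: (prod_coords_mod (K := 1%G) (b := 1) (a := a) (c :=
  c) (H := A) (y := y) (x := x) (w := w)) => //.
- exact: normal1.
- exact: quotient_abelian.
- by split; rewrite ?expg1n.
- move=> g gt; have /dvdnP [m yE] := yA g (tA g gt).
  by rewrite {1}(GE g (tG g gt)) yE mulnC expgM bp !expg1n.
Qed.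

End ExponentP.
End GroupsP3.

Section NonAbelianP3.
Variable gT : finGroupType.
Implicit Types (A G H K Z : {group gT}) (s t r : seq gT).
Local Open Scope group_scope.

Variables (p : nat) (p_prime : prime p).

Lemma gao_elementary_abelian G :
    #|G| = (p ^ 3)%N -> abelian G -> (forall g, g \in G -> g ^+ p = 1) ->
  gao G = (small_davenport G + #|G|)%N.
Proof.
move=> oG cGG Gp; have p1 := prime_gt1 p_prime.
have [|c cG c1] := @not_subset_card _ G 1 (sub1G _).
  by rewrite cards1 oG -(exp1n 3) ltn_exp2r.
have c_1 : c != 1 by apply: contraNneq c1 => ->; apply: group1.
have [||a aG ac] := @not_subset_card _ G <[c]>; first by rewrite cycle_subG.
  by rewrite -orderE (order_exponent p_prime Gp cG c_1) oG -{1}(expn1 p)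
    ltn_exp2l.
have cZ : c \in 'Z(G) by rewrite (center_idP cGG).
have [b [y [x [w [_ _ _ d_ge]]]]] :=
  elementary_basis p_prime oG Gp cZ c_1 aG ac.
apply: (gao_eq d_ge) => s sG; rewrite oG => ns.
have [t [r [str nt tK _]]] :=
  elementary_linear p_prime oG Gp cZ c_1 aG ac sG ns.
exists t, r; split=> //; apply/set1P; apply: (tK 1%G); first exact: normal1.
exact: quotient_abelian.
Qed.

(** * The nonabelian group of exponent p *)

Section NonAbelian.
Variable G : {group gT}.
Hypotheses (oG : #|G| = (p ^ 3)%N) (ncG : ~~ abelian G)
  (Gp : forall g, g \in G -> g ^+ p = 1).

Lemma center_p3 : #|'Z(G)| = p /\ abelian (G / 'Z(G)).
Proof.
have p1 := prime_gt1 p_prime; have p0 := ltnW p1.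
have pG : p.-group G by rewrite /pgroup oG pnatX pnat_id.
have nZG := normal_norm (center_normal G).
have /(dvdn_pfactor _ _ p_prime) [m m3 oZ] : #|'Z(G)| %| p ^ 3.
  by rewrite -oG cardSg // center_sub.
have oQ : #|G / 'Z(G)| = (p ^ (3 - m))%N.
  by rewrite card_quotient // -divgS ?center_sub // oG oZ -expnB.
have m1 : m = 1%N.
  case: m m3 oZ oQ => [|[|[|[|m]]]] // _ oZ oQ.
  - have Z1 : 'Z(G) = 1 by apply: card1_trivg; rewrite oZ.
    by case/negP: ncG; rewrite (trivg_center_pgroup pG Z1) abelian1.
  - case/negP: ncG; apply: cyclic_center_factor_abelian; apply: prime_cyclic.
    by rewrite oQ.
  - case/negP: ncG; have <- : 'Z(G) = G; last exact: center_abelian.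
    by apply/eqP; rewrite eqEcard center_sub oG oZ leqnn.
split; first by rewrite oZ m1.
apply: (p2group_abelian (quotient_pgroup _ pG)).
by rewrite oQ m1 pfactorK.
Qed.

Lemma noncentral_exists : exists2 a, a \in G & a \notin 'Z(G).
Proof.
apply/subsetPn; apply: contra ncG => sGZ.
by apply: abelianS sGZ (center_abelian G).
Qed.

(** The centralizer of a noncentral [a] contains the product of the center and
    [<[a]>], of order [p ^ 2], and it is not [G]. So it is the subgroup [A] to
    which the linearization above applies. *)
Lemma cent1_p3 a : a \in G -> a \notin 'Z(G) ->
  exists c, [/\ c \in 'Z(G), c != 1, a \notin <[c]> &
    <[c]> <*> <[a]> = 'C_G[a]].
Proof.
move=> aG aZ; have p1 := prime_gt1 p_prime; have [oZ _] := center_p3.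
have [|c cZ c1] := @not_subset_card _ 'Z(G)%G 1 (sub1G _).
  by rewrite cards1 oZ.
have c_1 : c != 1 by apply: contraNneq c1 => ->; apply: group1.
have cG : c \in G := subsetP (center_sub G) c cZ.
have cE : <[c]> = 'Z(G).
  by apply/eqP; rewrite eqEcard cycle_subG cZ -orderE (order_exponent p_prime
    Gp cG c_1) oZ leqnn.
have ac : a \notin <[c]> by rewrite cE.
have [sAG cAA oA _] := elementary_facts p_prime Gp cZ c_1 aG ac.
exists c; split=> //; apply/eqP; rewrite eqEcard.
have sAC : <[c]> <*> <[a]> \subset 'C_G[a].
  rewrite subsetI sAG sub_cent1; apply: subsetP (cAA : _ \subset _) _ _.
  by rewrite mem_gen // inE cycle_id orbT.
rewrite sAC oA.
have /(dvdn_pfactor _ _ p_prime) [m m3 oC] : #|'C_G[a]| %| p ^ 3.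
  by rewrite -oG cardSg // subsetIl.
rewrite oC leq_exp2l // -ltnS ltn_neqAle m3 andbT; apply: contra aZ => /eqP m_3.
have CG : 'C_G[a] = G by apply/eqP; rewrite eqEcard subsetIl oC m_3 oG leqnn.
by rewrite inE aG -sub_cent1 -{1}CG subsetIr.
Qed.

Lemma noncentral_linear a s :
    a \in G -> a \notin 'Z(G) -> {subset s <= G} ->
      size s = (p ^ 3 + 3 * p.-1)%N ->
  exists t r, [/\ perm_eq (t ++ r) s, size t = (p ^ 3)%N,
    \prod_(x <- t) x \in 'Z(G) & {subset t <= 'C_G[a]} -> \prod_(x <- t) x = 1].
Proof.
move=> aG aZ sG ns; have [c [cZ c1 ac CE]] := cent1_p3 aG aZ.
have [t [r [str nt tK tA]]] :=
  elementary_linear p_prime oG Gp cZ c1 aG ac sG ns.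
exists t, r; split=> //; last by move=> tC; apply: tA => x /tC; rewrite -CE.
by apply: tK; [apply: center_normal | case: center_p3].
Qed.

Lemma davenport_exponent_p_ge : 3 * p.-1 <= small_davenport G.
Proof.
have [a aG aZ] := noncentral_exists; have [c [cZ c1 ac _]] := cent1_p3 aG aZ.
by have [b [y [x [w []]]]] := elementary_basis p_prime oG Gp cZ c1 aG ac.
Qed.

Lemma card_cent1_p3 a : a \in G -> a \notin 'Z(G) ->
  #|'C_G[a]| = (p ^ 2)%N /\ abelian 'C_G[a].
Proof.
move=> aG aZ; have [c [cZ c1 ac CE]] := cent1_p3 aG aZ.
by have [_ cAA oA _] := elementary_facts p_prime Gp cZ c1 aG ac; rewrite -CE.
Qed.

(** Two centralizers of noncentral elements that share a noncentral [x] are both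
    the centralizer of [x]. *)
Lemma cent1_p3_eq a b x :
    a \in G -> a \notin 'Z(G) -> b \in G -> b \notin 'Z(G) ->
    x \in 'C_G[a] -> x \in 'C_G[b] -> x \notin 'Z(G) -> 'C_G[a] = 'C_G[b].
Proof.
move=> aG aZ bG bZ xa xb xZ; have xG : x \in G by case/setIP: xa.
have [ox _] := card_cent1_p3 xG xZ.
suff E y : y \in G -> y \notin 'Z(G) -> x \in 'C_G[y] -> 'C_G[y] = 'C_G[x].
  by rewrite (E a aG aZ xa) (E b bG bZ xb).
move=> yG yZ xy; have [oy cyy] := card_cent1_p3 yG yZ.
apply/eqP; rewrite eqEcard ox oy leqnn andbT subsetI subsetIl sub_cent1.
exact: subsetP (cyy : _ \subset _) _ xy.
Qed.

(** Pigeonhole over the [(p ^ 2).-1] nontrivial cosets of the center. *)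
Lemma dense_coset t :
    {subset t <= G} -> (p ^ 2).-1 * p.-2 < nb_out 'Z(G) t ->
  exists g, [/\ g \in G, g \notin 'Z(G) & p.-1 <= nb_in (g *: 'Z(G)) t].
Proof.
move=> tG lt_t; have p1 := prime_gt1 p_prime; have [oZ _] := center_p3.
have nZG := normal_norm (center_normal G).
pose Q := [pred C | C \in (G / 'Z(G))^#].
pose P := [pred x | (x \in G) && (x \notin 'Z(G))].
have oQ : #|Q| = (p ^ 2).-1.
  have := cardsD1 1 (G / 'Z(G));
    rewrite group1 card_quotient // -divgS ?center_sub //.
  by rewrite oG oZ expnS mulKn ?prime_gt0 // => ->.
have PQ x : P x -> Q (coset 'Z(G) x).
  case/andP=> xG xZ; rewrite !inE mem_quotient // andbT.
  by apply: contra xZ => /eqP; apply: coset_idr; apply: subsetP xG.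
have lt_P : #|Q| * p.-2 < count P t.
  by rewrite oQ; apply: leq_trans lt_t _; rewrite leq_eqVlt; apply/orP; left;
    apply/eqP;
     apply: eq_in_count => x /tG xG; rewrite /= xG.
have [C QC lt_C] := count_pigeonhole PQ lt_P.
have /hasP [g gt /= /andP [/andP [gG gZ] /eqP gC]] : has (fun x =>
  P x && (coset 'Z(G) x == C)) t.
  by rewrite has_count; apply: leq_trans lt_C.
exists g; split=> //; apply: leq_trans (leq_trans _ lt_C) _; first lia.
apply: sub_count => x /= /andP [/andP [xG _] /eqP xC].
have inN y : y \in G -> y \in 'N('Z(G)) by apply: subsetP.
rewrite mem_lcoset; apply: coset_idr; first by rewrite groupM ?groupV ?inN.
rewrite (morphM (coset_morphism _)) ?groupV ?inN //= (morphV (coset_morphism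
  _)) ?inN //=.
by rewrite gC xC mulVg.
Qed.

Hypothesis p_gt2 : 2 < p.

(** Linearize with respect to the centralizer of some [a], chosen to contain at
    least [p ^ 3] terms of [s] if any such centralizer does, and let [t] be the
    resulting subsequence. It has more than [(p ^ 2).-1 * p.-2] noncentral
    terms, since only [3 * p.-1] terms of [s] are left out. If [t] does not lie
    in ['C_G[a]], take a coset of some [g] containing [p.-1] terms of [t].
    Unless [t] lies in ['C_G[g]], [noncommuting_product_one] concludes. If it
    does, both ['C_G[g]] and ['C_G[a]] contain [p ^ 3] of the [p ^ 3 + 3 * p.-1]
    terms of [s], and they meet in the center; so [s] has at most [6 * p.-1]
    noncentral terms, which is excluded. *)
Lemma noncentral_has_product_one s :
    {subset s <= G} -> size s = (p ^ 3 + 3 * p.-1)%N ->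
    (p ^ 2).-1 * p.-2 + 3 * p.-1 < nb_out 'Z(G) s ->
  has_product_one (p ^ 3) s.
Proof.
move=> sG ns lt_s; have [oZ cGZ] := center_p3.
pose big g := [/\ g \in G, g \notin 'Z(G) & p ^ 3 <= nb_in 'C_G[g] s].
have [a [aG aZ a_big]] : exists a, [/\ a \in G, a \notin 'Z(G) &
    (exists g, big g) -> big a].
  have [[g gb]|nb] := pselect (exists g, big g).
    by exists g; case: (gb); split.
  by have [a aG aZ] := noncentral_exists; exists a.
have [t [r [str nt tZ tC]]] := noncentral_linear aG aZ sG ns.
have tG : {subset t <= G} by move=> x xt; apply: sG;
  rewrite -(perm_mem str) mem_cat xt.
have [tCa|/allPn [v vt vCa]] := boolP (all (mem 'C_G[a]) t).
  by exists t, r; split=> //; apply: tC; apply/allP.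
have szr : (size t + size r)%N = size s := perm_size_cat str.
have [|g [gG gZ le_g]] := dense_coset tG.
  have ct := nb_out_cat 'Z(G) str; have cr := nb_in_out 'Z(G) r.
  move: lt_s ct cr szr; rewrite nt ns; clear; lia.
have [tCg|/allPn [u ut uCg]] := boolP (all (mem 'C_G[g]) t); last first.
  have [|t' t't t'1] := noncommuting_product_one p_prime oZ cGZ tG tZ le_g gG
    ut.
    move=> cgu; case/negP: uCg; apply/setIP; split; first exact: tG.
    by apply/cent1P; apply: commute_sym.
  exists t', r; split=> //; last by rewrite (perm_size t't).
  by rewrite (permPr (_ : perm_eq s (t ++ r))) ?perm_cat2r // perm_sym.
have cgs : p ^ 3 <= nb_in 'C_G[g] s.
  by rewrite -(nb_in_cat _ str) nb_in_all ?nt ?leq_addr //; apply/allP.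
have [_ _ cas] := a_big (ex_intro _ g (And3 gG gZ cgs)).
have cZ : nb_in 'C_G[a] s + nb_in 'C_G[g] s <= size s + nb_in 'Z(G) s.
  apply: leq_trans (nb_inI _ _ _) _; rewrite leq_add2l.
  apply: sub_count => x /setIP [xa xg]; apply: contraNT vCa => xZ.
  by rewrite (cent1_p3_eq aG aZ gG gZ xa xg xZ); apply: (allP tCg).
have p_le : 3 * p.-1 <= (p ^ 2).-1 * p.-2 by move: p_gt2; clear; nia.
exfalso; move: (nb_in_out 'Z(G) s) cZ cgs cas lt_s p_le.
by rewrite ns; clear; lia.
Qed.

(** A sequence with too few noncentral terms for [noncentral_has_product_one]
    satisfies the hypotheses of [central_has_product_one]. Otherwise it is
    shortened to [p ^ 3 + 3 * p.-1] terms, discarding central ones first. *)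
Lemma gao_nonabelian_exponent_p : gao G = (small_davenport G + #|G|)%N.
Proof.
have d_ge := davenport_exponent_p_ge; have [oZ _] := center_p3.
apply/eqP; rewrite eqn_leq davenport_add_card_le_gao andbT.
apply: gao_le => s sG ns; rewrite oG in ns *; have p1 := prime_gt1 p_prime.
have [le_s|lt_s] := leqP (nb_out 'Z(G) s) ((p ^ 2).-1 * p.-2 + 3 * p.-1).
  rewrite -oG; apply: (central_has_product_one (Z := 'Z(G)%G)) => //=;
    rewrite ?oZ ?oG //.
    move: (nb_in_out 'Z(G) s) le_s d_ge; rewrite ns; move: p1; clear; nia.
  by move: le_s p1; clear; nia.
pose nc := predC (mem 'Z(G)).
pose s' : seq gT := filter nc s ++ filter (predC nc) s.
have s's : perm_eq s' s by rewrite perm_filterC.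
pose N := (p ^ 3 + 3 * p.-1)%N.
have N_le : N <= size s' by rewrite (perm_size s's) ns /N addnC leq_add2r.
apply: (perm_has_product_one s's); rewrite -(cat_take_drop N s').
apply: sub_has_product_one; apply: noncentral_has_product_one.
- by move=> x /mem_take; rewrite (perm_mem s's) => /sG.
- by rewrite size_takel.
have sz_nc : size (filter nc s) = nb_out 'Z(G) s by rewrite size_filter.
have all_nc : all nc (filter nc s) by apply: filter_all.
have nb_nc r : all nc r -> nb_out 'Z(G) r = size r.
  by rewrite all_count => /eqP.
have lt_N : (p ^ 2).-1 * p.-2 + 3 * p.-1 < N by rewrite /N; move: p1; clear;
  nia.
rewrite take_cat sz_nc; case: (ltnP N) => [le_N|ge_N].
  rewrite nb_nc; first by rewrite size_takel // sz_nc ltnW.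
  by apply/allP => x /mem_take; apply: (allP all_nc).
rewrite /nb_out count_cat -/(nb_out _ (filter nc s)) nb_nc // sz_nc.
exact: leq_trans lt_s (leq_addr _ _).
Qed.

End NonAbelian.

Lemma exponent2_abelian G : (forall g, g \in G -> g ^+ 2 = 1) -> abelian G.
Proof.
move=> G2; apply/centsP => x xG y yG.
have inv z : z \in G -> z^-1 = z.
  by move=> zG; apply/eqP; rewrite eq_invg_mul; apply/eqP/G2.
by rewrite /commute -[LHS]inv ?groupM // invMg !inv.
Qed.

End NonAbelianP3.

Theorem corollary4p1 (gT : finGroupType) (G : {group gT}) (p : nat)
    (p_prime : prime p) (cardG : #|G| = (p ^ 3)%N) :
  gao G = (small_davenport G + #|G|)%N.
Proof.
have p1 := prime_gt1 p_prime.
have [cyclicG|ncG] := boolP (cyclic G);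
  first exact: gao_cyclic_p3 p_prime _ cardG cyclicG.
have [[a aG oa]|no_p2] := pselect (exists2 a, a \in G & #[a]%g = (p ^ 2)%N).
  exact: gao_order_p2 p_prime _ _ cardG ncG aG oa.
have Gp g : g \in G -> (g ^+ p = 1)%g.
  move=> gG; have /(dvdn_pfactor _ _ p_prime) [m m3 og] : #[g]%g %| p ^ 3.
    by rewrite -cardG order_dvdG.
  apply/eqP; rewrite -order_dvdn og -[X in _ %| X]expn1 dvdn_exp2l //.
  case: m m3 og => [|[|[|[|m]]]] // _ og; first by case: no_p2; exists g.
  case/negP: ncG; apply/cyclicP; exists g; apply/eqP.
  by rewrite eq_sym eqEcard cycle_subG gG -orderE og cardG leqnn.
have [cGG|ncGG] := boolP (abelian G);
  first exact: gao_elementary_abelian p_prime _ cardG cGG Gp.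
apply: (gao_nonabelian_exponent_p p_prime cardG ncGG Gp).
rewrite ltn_neqAle p1 andbT; apply: contra ncGG => /eqP p2.
by apply: exponent2_abelian => g; rewrite p2; apply: Gp.
Qed.
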